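(* A map $\mathcal{M}$ is a non-orientable non-regular edge-transitive embedding of a complete graph $K_n$ if and only if $\mathcal{M}$ is isomorphic to the Petrie dual of a Biggs map $\mathcal{M}_n(c)$ for $n\ge 5$ or of a James map $\mathcal{M}_n(c,j)$ for $n\ge 7$.
   Context: A map is regular if its automorphism group acts transitively on vertex-edge-face flags, and edge-transitive if its automorphism group acts transitively on edges. The Petrie dual of a map embeds the same graph, with the faces replaced by the Petrie polygons (closed zig-zag paths turning alternately first right and first left at the vertices). For a prime power $n$, let $\mathbb{F}_n$ be the field of order $n$ and $c$ a primitive element of $\mathbb{F}_n$ (a generator of the cyclic group $\mathbb{F}_n^*$). The Biggs map $\mathcal{M}_n(c)$ is the Cayley map for the additive group of $\mathbb{F}_n$ with generating set $\mathbb{F}_n^*$ taken in the cyclic order $1, c, c^2, \ldots, c^{n-2}$. If $3<n=p^e\equiv 3$ mod $4$ with $p$ prime, and $j\in\mathbb{Z}_{n-1}\setminus\{1\}$ is odd, the James map $\mathcal{M}_n(c,j)$ is the Cayley map for $\mathbb{F}_n$ with generating set $\mathbb{F}_n^*$ in the cyclic order $1, c^j, c^2, c^{j+2}, c^4, c^{j+4}, \ldots, c^{n-3}, c^{j+n-3}$. *)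

(* Defs.v *)
From HB Require Import structures.
From mathcomp Require Import all_boot all_order all_algebra all_fingroup all_solvable all_field.

Set Implicit Arguments.
Unset Strict Implicit.
Unset Printing Implicit Defensive.

Import GRing.Theory.

(* A map is given by its finite set of flags (the triangles of the barycentric
   subdivision) and the three fixed-point-free involutions that change
   respectively the vertex, the edge and the face of a flag while keeping its
   other two components.  Freeness of r0, r1, r2 and r0 r2 means that the
   surface has no boundary and the graph no semi-edges; [flags_connected] means
   that the surface is connected.  The one embedding without flags, a single
   vertex on the sphere, is orientable; its vertex is not seen by [vertices]. *)
Record surface_map := SurfaceMap {
  flag : finType;
  r0 : flag -> flag;
  r1 : flag -> flag;
  r2 : flag -> flag;
  r0K : involutive r0;
  r1K : involutive r1;
  r2K : involutive r2;
  r0_r2C : forall x, r0 (r2 x) = r2 (r0 x);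
  r0_free : forall x, r0 x != x;
  r1_free : forall x, r1 x != x;
  r2_free : forall x, r2 x != x;
  r0_r2_free : forall x, r0 (r2 x) != x;
  flags_connected : forall x y,
    connect [rel a b | [|| b == r0 a, b == r1 a | b == r2 a]] x y
}.

Section MapTheory.

Variable M : surface_map.
Implicit Types x y : flag M.

(* Vertices, edges and faces are the orbits of the flags under r1 and r2, under
   r0 and r2, and under r0 and r1; as these are involutions, [connect] is
   symmetric. *)
Definition vertex x : {set flag M} :=
  [set y | connect [rel a b | (b == r1 a) || (b == r2 a)] x y].

Definition edge x : {set flag M} :=
  [set y | connect [rel a b | (b == r0 a) || (b == r2 a)] x y].

Definition vertices : {set {set flag M}} := [set vertex x | x : flag M].
Definition edges : {set {set flag M}} := [set edge x | x : flag M].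

Definition ends (e : {set flag M}) : {set {set flag M}} :=
  [set v in vertices | ~~ [disjoint v & e]].

(* No loops, no multiple edges, and every pair of distinct vertices joined. *)
Definition embeds_complete_graph (n : nat) : Prop :=
  [/\ #|vertices| = n,
      {in edges &, injective ends}
    & ends @: edges = [set A : {set {set flag M}} |
                         (A \subset vertices) && (#|A| == 2)]].

(* r0, r1, r2 all reverse a local orientation of the surface. *)
Definition orientable : Prop :=
  exists o : flag M -> bool,
    forall x, [/\ o (r0 x) = ~~ o x, o (r1 x) = ~~ o x & o (r2 x) = ~~ o x].

Definition map_aut : {set {perm flag M}} :=
  [set g : {perm flag M} | [forall x,
     [&& g (r0 x) == r0 (g x), g (r1 x) == r1 (g x) & g (r2 x) == r2 (g x)]]].

Lemma map_autP (g : {perm flag M}) :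
  reflect (forall x, [/\ g (r0 x) = r0 (g x), g (r1 x) = r1 (g x)
                       & g (r2 x) = r2 (g x)])
          (g \in map_aut).
Proof.
rewrite inE; apply: (iffP forallP) => H x.
  by have /and3P[/eqP ? /eqP ? /eqP ?] := H x.
by have [-> -> ->] := H x; rewrite !eqxx.
Qed.

Lemma map_aut_group_set : group_set map_aut.
Proof.
apply/group_setP; split; first by apply/map_autP => x; rewrite !perm1.
move=> g h /map_autP Hg /map_autP Hh; apply/map_autP => x; rewrite !permM.
by have [-> -> ->] := Hg x; have [-> -> ->] := Hh (g x).
Qed.

Canonical map_aut_group := Group map_aut_group_set.

Definition regular_map : Prop :=
  [transitive map_aut, on [set: flag M] | 'P].

Definition edge_transitive_map : Prop :=
  [transitive map_aut, on edges | 'P^*].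

End MapTheory.

Definition map_isomorphic (M N : surface_map) : Prop :=
  exists f : flag M -> flag N,
    bijective f /\
    forall x, [/\ f (r0 x) = r0 (f x), f (r1 x) = r1 (f x)
                & f (r2 x) = r2 (f x)].

Section PetrieDual.

Variable M : surface_map.

(* A zig-zag path crosses to the other side of each edge while running along
   it, so that the Petrie polygons are the orbits of r0 r2 and r1. *)
Definition petrie_r0 (x : flag M) : flag M := r0 (r2 x).

Fact petrie_r0K : involutive petrie_r0.
Proof. by move=> x; rewrite /petrie_r0 -[r2 (r0 _)]r0_r2C r0K r2K. Qed.

Fact petrie_r0_r2C x : petrie_r0 (r2 x) = r2 (petrie_r0 x).
Proof. by rewrite /petrie_r0 r0_r2C. Qed.

Fact petrie_r0_r2_free x : petrie_r0 (r2 x) != x.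
Proof. by rewrite /petrie_r0 r2K r0_free. Qed.

Fact petrie_connected (x y : flag M) :
  connect [rel a b | [|| b == petrie_r0 a, b == r1 a | b == r2 a]] x y.
Proof.
apply: connect_sub (flags_connected x y) => a b /= /or3P[] /eqP->.
- apply: (connect_trans (y := r2 a)); apply: connect1 => /=.
    by rewrite eqxx !orbT.
  by rewrite /petrie_r0 r2K eqxx.
- by apply: connect1; rewrite /= eqxx orbT.
- by apply: connect1; rewrite /= eqxx !orbT.
Qed.

Definition petrie_dual : surface_map :=
  SurfaceMap petrie_r0K (@r1K M) (@r2K M) petrie_r0_r2C (@r0_r2_free M)
    (@r1_free M) (@r2_free M) petrie_r0_r2_free petrie_connected.

End PetrieDual.

Section CayleyMap.

Variable G : finZmodType.

(* The cyclically ordered sequence s may be used as the rotation of a Cayley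
   map. *)
Definition rotation_seq (s : seq G) : Prop :=
  [/\ uniq s, (0 : G)%R \notin s, {in s, forall x, (- x)%R \in s}
    & (<<[set x in s]>> = [set: G])%g].

Variables (s : seq G) (Hs : rotation_seq s).

(* The flag (v, x, b) lies at the vertex v, on the edge from v to v + x, and
   on the side of this edge towards v + next s x if b = true, towards
   v + prev s x if b = false. *)
Definition cayley_flag : finType := (G * seq_sub s * bool)%type.

Fact rotation_oppP (x : seq_sub s) : (- ssval x)%R \in s.
Proof. by case: Hs => _ _ + _; apply; apply: ssvalP. Qed.

Fact rotation_nextP (x : seq_sub s) : next s (ssval x) \in s.
Proof. by rewrite mem_next ssvalP. Qed.

Fact rotation_prevP (x : seq_sub s) : prev s (ssval x) \in s.
Proof. by rewrite mem_prev ssvalP. Qed.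

(* The same side of an edge has opposite names at its two ends. *)
Definition cayley_r0 (f : cayley_flag) : cayley_flag :=
  let: (v, x, b) := f in ((v + ssval x)%R, SeqSub (rotation_oppP x), ~~ b).

Definition cayley_r1 (f : cayley_flag) : cayley_flag :=
  let: (v, x, b) := f in
  (v, if b then SeqSub (rotation_nextP x) else SeqSub (rotation_prevP x), ~~ b).

Definition cayley_r2 (f : cayley_flag) : cayley_flag :=
  let: (v, x, b) := f in (v, x, ~~ b).

Fact cayley_r0K : involutive cayley_r0.
Proof.
move=> [[v x] b] /=; rewrite addrK negbK; congr (_, _, _).
by apply: val_inj; rewrite /= opprK.
Qed.

Fact cayley_r1K : involutive cayley_r1.
Proof.
have [Us _ _ _] := Hs.
move=> [[v x] b]; rewrite /= negbK; congr (_, _, _); apply: val_inj.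
by case: b; rewrite /= ?prev_next ?next_prev.
Qed.

Fact cayley_r2K : involutive cayley_r2.
Proof. by move=> [[v x] b] /=; rewrite negbK. Qed.

Fact cayley_r0_r2C f : cayley_r0 (cayley_r2 f) = cayley_r2 (cayley_r0 f).
Proof. by case: f => [[v x] b]. Qed.

Fact cayley_r0_free f : cayley_r0 f != f.
Proof. by case: f => [[v x] b]; apply/eqP=> -[_ _]; case: b. Qed.

Fact cayley_r1_free f : cayley_r1 f != f.
Proof. by case: f => [[v x] b]; apply/eqP=> -[_]; case: b. Qed.

Fact cayley_r2_free f : cayley_r2 f != f.
Proof. by case: f => [[v x] b]; apply/eqP=> -[]; case: b. Qed.

Fact cayley_r0_r2_free f : cayley_r0 (cayley_r2 f) != f.
Proof.
case: f => [[v x] b]; apply/eqP=> -[/eqP + _ _].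
rewrite -subr_eq0 addrC addKr => /eqP x0.
by have [_ /negP s0 _ _] := Hs; apply: s0; rewrite -x0 ssvalP.
Qed.

Fact cayley_connected (f g : cayley_flag) :
  connect [rel a b | [|| b == cayley_r0 a, b == cayley_r1 a
                       | b == cayley_r2 a]] f g.
Proof.
have [Us _ _ genS] := Hs.
set e := [rel a b | _].
have e0 a : connect e a (cayley_r0 a) by apply: connect1; rewrite /= eqxx.
have e1 a : connect e a (cayley_r1 a).
  by apply: connect1; rewrite /= eqxx orbT.
have e2 a : connect e a (cayley_r2 a).
  by apply: connect1; rewrite /= eqxx !orbT.
have side v x b b' : connect e (v, x, b) (v, x, b').
  by case: b; case: b'; rewrite ?connect0 //; apply: (e2 (v, x, _)).
have turn v (x y : seq_sub s) b b' : connect e (v, x, b) (v, y, b').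
  have /iter_findex : fconnect (next s) (ssval x) (ssval y).
    by rewrite (fconnect_cycle (cycle_next Us) (ssvalP x)) ssvalP.
  move: (findex _ _ _) => k; elim: k x => [|k IHk] x.
    by move=> /= /val_inj->; apply: side.
  rewrite iterSr => Dy.
  apply: connect_trans (side v x b true) _.
  apply: connect_trans (e1 _) _.
  exact: (connect_trans (side _ _ _ b) (IHk (SeqSub (rotation_nextP x)) Dy)).
case: f g => [[v x] b] [[w y] b'].
have /gen_prodgP[k [c sc Dw]] : (w - v)%R \in <<[set x in s]>>%g.
  by rewrite genS inE.
have {Dw} -> : w = (v + \sum_(i < k) c i)%R.
  by rewrite -[w](subrK v) addrC Dw.
elim: k c sc v x b => [|k IHk] c sc v x b; first by rewrite big_ord0 addr0.
have c0s : c ord0 \in s by have := sc ord0; rewrite inE.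
apply: connect_trans (turn v x (SeqSub c0s) b b) _.
apply: connect_trans (e0 _) _.
by rewrite big_ord_recl addrA; apply: IHk.
Qed.

Definition cayley_map : surface_map :=
  SurfaceMap cayley_r0K cayley_r1K cayley_r2K cayley_r0_r2C cayley_r0_free
    cayley_r1_free cayley_r2_free cayley_r0_r2_free cayley_connected.

End CayleyMap.

Section FieldMaps.

Variables (F : finFieldType) (c : {unit F}).

(* 1, c, c^2, ..., c^(n-2), where n = #|F| *)
Definition biggs_seq : seq F :=
  [seq FinRing.uval (c ^+ i)%g | i <- iota 0 #|F|.-1].

(* 1, c^j, c^2, c^(j+2), c^4, c^(j+4), ..., c^(n-3), c^(j+n-3).  The number j stands for
   its class modulo n - 1, which is even when n = 3 modulo 4, so that the parity
   of j makes sense. *)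
Definition james_seq (j : nat) : seq F :=
  flatten [seq [:: FinRing.uval (c ^+ (2 * i))%g;
                   FinRing.uval (c ^+ (j + 2 * i))%g]
             | i <- iota 0 #|F|.-1./2].

Lemma rotation_seq_nonzero (s : seq F) :
  size s = #|F|.-1 -> s =i [pred x | x != 0%R] -> rotation_seq s.
Proof.
move=> size_s mem_s; split.
- apply/card_uniqP; rewrite size_s -(cardC1 (0%R : F)).
  by apply: eq_card => x; rewrite mem_s.
- by rewrite mem_s inE eqxx.
- by move=> x; rewrite !mem_s !inE oppr_eq0.
apply/setP=> x; rewrite [RHS]inE.
have [->|x0] := eqVneq x 0%R; first exact: group1.
by rewrite mem_gen // inE mem_s.
Qed.

Hypothesis c_gen : generator [set: {unit F}] c.

Lemma order_primitive : #[c]%g = #|F|.-1.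
Proof. by rewrite orderE -(eqP c_gen) card_finField_unit. Qed.

Lemma primitive_powerP (x : F) :
  x != 0%R -> exists2 i, i < #|F|.-1 & x = FinRing.uval (c ^+ i)%g.
Proof.
move=> x0; have Ux : x \is a GRing.unit by rewrite unitfE.
have : FinRing.Unit Ux \in <[c]>%g by rewrite -(eqP c_gen) inE.
case/cyclePmin=> i lt_i Dx; exists i; first by rewrite -order_primitive.
by rewrite -Dx.
Qed.

Lemma biggs_rotation : rotation_seq biggs_seq.
Proof.
apply: rotation_seq_nonzero; first by rewrite size_map size_iota.
move=> x; rewrite inE; apply/mapP/idP=> [[i _ ->]|/primitive_powerP[i lt_i ->]].
  by rewrite -unitfE (valP (c ^+ i)%g).
by exists i; rewrite // mem_iota.
Qed.

Definition biggs_map : surface_map := cayley_map biggs_rotation.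

Lemma james_rotation j : #|F| %% 4 = 3 -> odd j -> rotation_seq (james_seq j).
Proof.
move=> F3 odd_j; set m := #|F|.-1./2.
have DF : #|F|.-1 = m.*2.
  rewrite /m; have -> : #|F| = #|F| %/ 4 * 4 + 3 by rewrite {1}(divn_eq #|F| 4) F3.
  by rewrite even_halfK // addnS /= oddD oddM andbF.
apply: rotation_seq_nonzero.
  rewrite size_flatten /shape -map_comp -/m DF.
  rewrite (eq_map (g := fun=> 2)) // sumnE big_map big_const_seq count_predT.
  by rewrite size_iota iter_addn_0 mul2n.
move=> x; rewrite inE; apply/flatten_mapP/idP => [[i _]|].
  by rewrite !inE => /orP[]/eqP->; rewrite -unitfE; apply: valP.
case/primitive_powerP=> k lt_k ->.
have ck : (c ^+ #|F|.-1 = 1)%g by rewrite -order_primitive expg_order.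
have m_gt0 : 0 < m by move: lt_k; rewrite DF; case: (m).
have [odd_k|even_k] := boolP (odd k); last first.
  exists k./2; last by rewrite mul2n even_halfK // mem_head.
  by rewrite mem_iota /= add0n -ltn_double -DF even_halfK.
pose t := (k + j * (#|F|.-1).-1)./2.
have Dt : t.*2 = k + j * (#|F|.-1).-1.
  rewrite /t even_halfK // oddD oddM odd_k odd_j /= DF.
  by case: (m) m_gt0 => // m' _; rewrite doubleS /= odd_double.
exists (t %% m); first by rewrite mem_iota ltn_mod.
rewrite !inE; apply/orP; right; apply/eqP; congr (FinRing.uval _).
apply/eqP; rewrite eq_expg_mod_order order_primitive DF -mul2n muln_modr.
rewrite modnDmr [2 * t]mul2n Dt addnCA -mulnS prednK ?DF ?double_gt0 //.
by rewrite -mul2n addnC modnMDl.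
Qed.

Definition james_map (j : nat) (F3 : #|F| %% 4 = 3) (odd_j : odd j) :
  surface_map := cayley_map (james_rotation F3 odd_j).

End FieldMaps.

(* Main.v *)
Require Import Defs.
From HB Require Import structures.
From mathcomp Require Import all_boot all_order all_algebra all_fingroup all_solvable all_field.
From mathcomp Require Import vcharacter ring zify.
(* burnside_app also exports r0 and r1. *)
Import Defs.

Set Implicit Arguments.
Unset Strict Implicit.
Unset Printing Implicit Defensive.

Import GRing.Theory.

(* Let G be the automorphism group of a map M as in the statement.  It acts
   freely on the flags.  An automorphism sending a flag x to r2 x would fix all
   vertices, so that a vertex would have at most four flags; hence, once
   3 < n, the stabilizer in G of two vertices is trivial.  As M is not regular,
   G has two or four orbits on the flags.  Comparing the action of r1 on these
   orbits with that of r0 and r2 leaves, by non-orientability, the case where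
   the Petrie dual of M is orientable and G preserves its orientation, and the
   case where each corner at a vertex is reversed by an automorphism.

   G is a Frobenius group on the vertices; its kernel K is regular on them.
   Edge-transitivity fuses any nontrivial k, k' in K up to inversion, so K is
   an elementary abelian group.  Involutions fixing a vertex invert K, so there
   is at most one of them, which excludes the second case.  In the first one
   the stabilizer of a vertex is generated by one or two steps of the rotation,
   and every nontrivial element of K is a conjugate of a fixed k0 under a power
   of this generator h, up to inversion.  Then K is the additive group of a
   field with unit k0 in which conjugation by h is a multiplication, and the
   rotation of M becomes that of a Biggs or James map.

   Conversely, a reflection of a Biggs or James map fixing the flag at 0
   towards 1 acts as inversion both on (the squares of) the rotation at 0 and,
   after the translation by 1, on that at 1, which gives an impossible
   quadratic equation. *)

(** * Flags, vertices, edges and automorphisms *)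


Section Incidence.

Variable M : surface_map.
Implicit Types x y z : flag M.

Lemma r2_r0C x : r2 (r0 x) = r0 (r2 x).
Proof. by rewrite r0_r2C. Qed.

Lemma flag_ind (P : flag M -> Prop) x :
    (forall z, P z -> P (r0 z)) -> (forall z, P z -> P (r1 z)) ->
    (forall z, P z -> P (r2 z)) -> P x ->
  forall y, P y.
Proof.
move=> P0 P1 P2 Px y; have /connectP[p + ->] := flags_connected x y.
elim: p x Px => //= z p IHp x Px /andP[/or3P[]/eqP Dz pth_p];
  by apply: IHp pth_p; rewrite Dz; auto.
Qed.

Lemma vertex_connect_sym :
  connect_sym [rel a b : flag M | (b == r1 a) || (b == r2 a)].
Proof.
apply: sym_connect_sym => a b /=.
rewrite -(can2_eq (@r1K M) (@r1K M)) -(can2_eq (@r2K M) (@r2K M)).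
by rewrite eq_sym [_ == r2 _]eq_sym.
Qed.

Lemma mem_vertex x y : (y \in vertex x) = (vertex x == vertex y).
Proof.
apply/idP/eqP => [|->]; last by rewrite inE connect0.
rewrite inE => xy; apply/setP=> z; rewrite !inE.
exact: same_connect vertex_connect_sym _ _ xy z.
Qed.

Lemma vertex_r1 x : vertex (r1 x) = vertex x.
Proof.
by apply/esym/eqP; rewrite -mem_vertex inE; apply: connect1; rewrite /= eqxx.
Qed.

Lemma vertex_r2 x : vertex (r2 x) = vertex x.
Proof.
apply/esym/eqP; rewrite -mem_vertex inE.
by apply: connect1; rewrite /= eqxx orbT.
Qed.

Lemma vertex_r0_r2 x : vertex (r0 (r2 x)) = vertex (r0 x).
Proof. by rewrite r0_r2C vertex_r2. Qed.

Lemma vertex_ind (P : flag M -> Prop) x :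
    (forall z, P z -> P (r1 z)) -> (forall z, P z -> P (r2 z)) -> P x ->
  forall y, vertex x = vertex y -> P y.
Proof.
move=> P1 P2 Px y /eqP; rewrite -mem_vertex inE => /connectP[p + ->].
elim: p x Px => //= z p IHp x Px /andP[/orP[]/eqP Dz pth_p];
  by apply: IHp pth_p; rewrite Dz; auto.
Qed.

Lemma vertex_in x : vertex x \in vertices M.
Proof. exact: imset_f. Qed.

(** [r0] and [r2] commute, so they generate a Klein four-group. *)
Lemma edgeE x : edge x = [set x; r0 x; r2 x; r0 (r2 x)].
Proof.
apply/setP=> y; rewrite !inE -!orbA; apply/idP/idP => [/connectP[p]|].
  suff S t : [\/ t = x, t = r0 x, t = r2 x | t = r0 (r2 x)] ->
      path [rel a b : flag M | (b == r0 a) || (b == r2 a)] t p -> y = last t p ->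
      [\/ y = x, y = r0 x, y = r2 x | y = r0 (r2 x)].
    by move=> pth /(S x (Or41 _ _ _ erefl) pth)[] ->; rewrite eqxx ?orbT.
  elim: p t => [|z p IHp] t tE /=; first by move=> _ ->.
  case/andP=> tz; apply: IHp; case/orP: tz tE => /eqP->; case=> ->;
    rewrite ?r0K -?r0_r2C ?r2K;
    by [exact: Or41|exact: Or42|exact: Or43|exact: Or44].
have e0 z : connect [rel a b : flag M | (b == r0 a) || (b == r2 a)] z (r0 z).
  by apply: connect1; rewrite /= eqxx.
have e2 z : connect [rel a b : flag M | (b == r0 a) || (b == r2 a)] z (r2 z).
  by apply: connect1; rewrite /= eqxx orbT.
case/or4P=> /eqP->; rewrite ?connect0 //.
exact: connect_trans (e2 x) (e0 _).
Qed.

Lemma mem_edge x y :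
  y \in edge x -> [\/ y = x, y = r0 x, y = r2 x | y = r0 (r2 x)].
Proof.
rewrite edgeE !inE -!orbA => /or4P[] /eqP->;
  [exact: Or41|exact: Or42|exact: Or43|exact: Or44].
Qed.

Lemma edge_r2 x : edge (r2 x) = edge x.
Proof.
by apply/setP=> y; rewrite !edgeE !inE r2K; do !case: (y == _) => //.
Qed.

Lemma edge_r0 x : edge (r0 x) = edge x.
Proof.
by apply/setP=> y; rewrite !edgeE !inE r2_r0C !r0K; do !case: (y == _) => //.
Qed.

Lemma ends_edge x : ends (edge x) = [set vertex x; vertex (r0 x)].
Proof.
apply/setP=> A; rewrite inE in_set2; apply/idP/idP.
  case/andP=> /imsetP[z _ ->] /pred0Pn[w /=]; rewrite mem_vertex.
  case/andP=> [/eqP-> /mem_edge[]->];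
  by rewrite ?vertex_r0_r2 ?vertex_r2 eqxx ?orbT.
case/orP=> /eqP->; rewrite vertex_in /=; apply/pred0Pn.
  by exists x; rewrite /= mem_vertex edgeE !inE !eqxx.
by exists (r0 x); rewrite /= mem_vertex edgeE !inE !eqxx !orbT.
Qed.

Lemma edges_in x : edge x \in edges M.
Proof. exact: imset_f. Qed.

(** [embeds_complete_graph] in terms of flags: up to [r2], a flag x is the arc from [vertex x] to
    [vertex (r0 x)]. *)
Definition complete_incidence (n : nat) : Prop :=
  [/\ #|vertices M| = n,
      forall x, vertex (r0 x) <> vertex x,
      forall x y, vertex x = vertex y -> vertex (r0 x) = vertex (r0 y) ->
        y = x \/ y = r2 x
    & forall x y, vertex x <> vertex y ->
        exists z, vertex z = vertex x /\ vertex (r0 z) = vertex y].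

Lemma embeds_complete_graphP n :
  embeds_complete_graph M n <-> complete_incidence n.
Proof.
split=> [[cardV injE ends2]|[cardV loopless simple joined]].
  have V2 x : vertex (r0 x) <> vertex x.
    move=> loop; have: ends (edge x) \in [set ends e | e in edges M].
      exact/imset_f/edges_in.
    by rewrite ends2 inE ends_edge loop setUid cards1 andbF.
  split=> // [x y Dv Dw|x y nv].
    have: edge x = edge y.
      by apply: injE; rewrite ?edges_in // !ends_edge Dv Dw.
    move/setP/(_ y); rewrite (edgeE y) !inE eqxx => yx.
    have /mem_edge[] : y \in edge x by rewrite inE yx.
    - by left.
    - by move=> Dy; case: (V2 x); rewrite -Dy.
    - by right.
    - by move=> Dy; case: (V2 x); rewrite -[LHS]vertex_r0_r2 -Dy.
  have: [set vertex x; vertex y] \in [set ends e | e in edges M].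
    rewrite ends2 inE cards2 (introF eqP nv) andbT.
    by apply/subsetP=> A; rewrite !inE => /orP[]/eqP->; apply: vertex_in.
  case/imsetP=> _ /imsetP[z _ ->]; rewrite ends_edge => /setP Dxy.
  have:= Dxy (vertex x); have:= Dxy (vertex y); rewrite !inE !eqxx orbT /=.
  move=> /esym/orP[]/eqP Dy /esym/orP[]/eqP Dx.
  - by case: nv; rewrite Dx Dy.
  - by exists (r0 z); rewrite Dx r0K Dy.
  - by exists z; rewrite Dx Dy.
  - by case: nv; rewrite Dx Dy.
split=> //.
  move=> _ _ /imsetP[x _ ->] /imsetP[y _ ->]; rewrite !ends_edge => /setP Dxy.
  have:= Dxy (vertex (r0 y)); have:= Dxy (vertex y).
  rewrite !inE !eqxx orbT /= => /orP[]/eqP Dx /orP[]/eqP Dy.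
  - by case: (loopless y); rewrite Dx Dy.
  - by case: (simple x y); [rewrite Dx|rewrite Dy|move->|move->; rewrite edge_r2].
  - case: (simple x (r0 y)); rewrite ?r0K //; rewrite -(edge_r0 y) => -> //.
    by rewrite edge_r2.
  - by case: (loopless y); rewrite Dx Dy.
apply/setP=> A; rewrite inE; apply/imsetP/andP => [[_ /imsetP[x _ ->] ->]|[sAV +]].
  rewrite ends_edge cards2 (introF eqP (nesym (@loopless x))); split=> //.
  by apply/subsetP=> B; rewrite !inE => /orP[]/eqP->; apply: vertex_in.
case/cards2P=> u [v [nuv DA]]; rewrite {}DA in sAV *.
have /imsetP[x _ Du] : u \in vertices M by apply: (subsetP sAV); rewrite !inE eqxx.
have /imsetP[y _ Dv] : v \in vertices M.
  by apply: (subsetP sAV); rewrite !inE eqxx orbT.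
have [|z [Dx Dy]] := joined x y; first by rewrite -Du -Dv; apply/eqP.
by exists (edge z); rewrite ?edges_in // ends_edge Dx Dy -Du -Dv.
Qed.

End Incidence.

(** * Morphisms, automorphisms and invariance under isomorphism *)

Section Morphisms.

Definition map_morphism (M N : surface_map) (f : flag M -> flag N) : Prop :=
  forall x, [/\ f (r0 x) = r0 (f x), f (r1 x) = r1 (f x)
              & f (r2 x) = r2 (f x)].

Lemma map_morphism_inv (M N : surface_map) (f : flag M -> flag N) g :
  cancel f g -> cancel g f -> map_morphism f -> map_morphism g.
Proof.
move=> fK gK mf x; have [f0 f1 f2] := mf (g x).
by split; apply: (can_inj fK); rewrite gK (f0, f1, f2) gK.
Qed.

Lemma map_morphism_comp (L M N : surface_map) (f : flag M -> flag N)
    (g : flag L -> flag M) :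
  map_morphism f -> map_morphism g -> map_morphism (f \o g).
Proof.
move=> mf mg x; have [g0 g1 g2] := mg x; have [f0 f1 f2] := mf (g x).
by rewrite /= g0 g1 g2 f0 f1 f2.
Qed.

Lemma map_isomorphic_sym M N : map_isomorphic M N -> map_isomorphic N M.
Proof.
case=> f [[g fK gK] mf]; exists g; split; first by exists f.
exact: map_morphism_inv mf.
Qed.

Lemma morphism_vertex M N (f : flag M -> flag N) x y :
  map_morphism f -> vertex x = vertex y -> vertex (f x) = vertex (f y).
Proof.
move=> mf; apply: (@vertex_ind M (fun z => vertex (f x) = vertex (f z))) => // z ->.
  by case: (mf z) => _ -> _; rewrite vertex_r1.
by case: (mf z) => _ _ ->; rewrite vertex_r2.
Qed.

Lemma autM (M : surface_map) (g : {perm flag M}) :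
  g \in map_aut M -> map_morphism g.
Proof. by move/map_autP. Qed.

Lemma aut_of_morphism (M : surface_map) (f : flag M -> flag M) :
  map_morphism f -> injective f -> exists2 g, g \in map_aut M & g =1 f.
Proof.
move=> mf injf; exists (perm injf); last exact: permE.
by apply/map_autP=> x; rewrite !permE.
Qed.

(** Agreement at one flag spreads along [r0], [r1] and [r2] by connectedness. This is why
    automorphisms act freely on flags. *)
Lemma morphism_eq (M N : surface_map) (f g : flag M -> flag N) x :
  map_morphism f -> map_morphism g -> f x = g x -> f =1 g.
Proof.
move=> mf mg; apply: (@flag_ind M (fun z => f z = g z)) => z Dz;
  by case: (mf z) (mg z) => f0 f1 f2 [g0 g1 g2]; rewrite ?(f0, f1, f2) Dz.
Qed.

Lemma aut_free (M : surface_map) (g : {perm flag M}) x :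
  g \in map_aut M -> g x = x -> g = 1%g.
Proof.
move=> Gg gx; apply/permP; apply: (@morphism_eq _ _ _ _ x (autM Gg) (autM (group1 _))).
by rewrite gx perm1.
Qed.

Lemma aut_vertex M (g : {perm flag M}) x y :
  g \in map_aut M -> (vertex (g x) = vertex (g y)) <-> (vertex x = vertex y).
Proof.
move=> Gg; split; last exact/morphism_vertex/autM.
move/(morphism_vertex (autM (groupVr Gg))).
by rewrite -!permM mulgV !perm1.
Qed.

Lemma setact_vertex M (g : {perm flag M}) x :
  g \in map_aut M -> ('P^*)%act (vertex x) g = vertex (g x).
Proof.
move=> Gg; apply/setP=> y; apply/imsetP/idP => [[z xz ->]|].
  by move: xz; rewrite !mem_vertex => /eqP xz; apply/eqP/aut_vertex.
rewrite mem_vertex => /eqP xy; exists ((g^-1)%g y); last first.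
  by rewrite /= /aperm permKV.
by rewrite mem_vertex; apply/eqP/(aut_vertex _ _ Gg); rewrite permKV.
Qed.

Lemma setact_edge M (g : {perm flag M}) x :
  g \in map_aut M -> ('P^*)%act (edge x) g = edge (g x).
Proof.
move=> Gg; have [g0 _ g2] := autM Gg x; have [g02 _ _] := autM Gg (r2 x).
by rewrite /= setactE !edgeE !imsetU !imset_set1 /= /aperm g0 g02 g2.
Qed.

Lemma edge_transitiveP M (x0 : flag M) :
  edge_transitive_map M <->
  forall x y, exists2 g, g \in map_aut M & y \in edge (g x).
Proof.
split=> [trE x y|trE].
  have [g Gg Dy] := atransP2 trE (edges_in x) (edges_in y).
  exists g => //; rewrite -setact_edge //; have := Dy => /= <-.
  by rewrite edgeE !inE eqxx.
apply/imsetP; exists (edge x0); first exact: edges_in.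
apply/setP=> A; apply/imsetP/imsetP => [[y _ ->]|[g Gg ->]].
  have [g Gg yE] := trE x0 y; exists g => //=; rewrite setact_edge //.
  by case: (mem_edge yE) => ->; rewrite ?edge_r0 ?edge_r2.
by exists (g x0); rewrite // setact_edge.
Qed.

Lemma regularP M (x0 : flag M) :
  regular_map M <-> forall x y, exists2 g, g \in map_aut M & y = g x.
Proof.
split=> [trF x y|trF]; first exact: (atransP2 trF (in_setT x) (in_setT y)).
apply/imsetP; exists x0 => //; apply/esym/setP=> y; rewrite [RHS]inE.
by apply/imsetP; have [g Gg ->] := trF x0 y; exists g.
Qed.

Variables (M N : surface_map).
Hypothesis isoMN : map_isomorphic M N.

Lemma iso_embeds n : embeds_complete_graph M n -> embeds_complete_graph N n.
Proof.
case: isoMN => f [[g fK gK] mf]; have mg := map_morphism_inv fK gK mf.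
have Vf x y : vertex (f x) = vertex (f y) <-> vertex x = vertex y.
  split; last exact: morphism_vertex.
  by move/(morphism_vertex mg); rewrite !fK.
have f0 x : f (r0 x) = r0 (f x) by case: (mf x).
have f2 x : f (r2 x) = r2 (f x) by case: (mf x).
move=> /embeds_complete_graphP[<- loopless simple joined].
apply/embeds_complete_graphP; split.
- have -> : vertices N = [set [set f z | z in A] | A : {set flag M} in vertices M].
    have imV x : [set f z | z in vertex x] = vertex (f x).
      apply/setP=> y; rewrite -(gK y) mem_imset; last exact: can_inj fK.
      by rewrite !mem_vertex; apply/eqP/eqP=> /Vf.
    apply/setP=> A; apply/imsetP/imsetP => [[y _ ->]|[_ /imsetP[x _ ->] ->]].
      by exists (vertex (g y)); rewrite ?vertex_in // imV gK.
    by exists (f x); rewrite ?imV.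
  by rewrite card_imset //; apply/imset_inj/can_inj/fK.
- by move=> x; rewrite -(gK x) -f0 => /Vf; apply: loopless.
- move=> x y; rewrite -(gK x) -(gK y) -!f0 -f2 => /Vf Dv /Vf Dw.
  by case: (simple _ _ Dv Dw) => ->; [left|right].
- move=> x y; rewrite -(gK x) -(gK y) => nv.
  have [|z [Dx Dy]] := joined (g x) (g y); first by move=> /Vf.
  by exists (f z); rewrite -f0; split; apply/Vf.
Qed.

Lemma iso_orientable : orientable M -> orientable N.
Proof.
case: isoMN => f [[g fK gK] mf]; have mg := map_morphism_inv fK gK mf.
case=> o Do; exists (o \o g) => x; have [g0 g1 g2] := mg x.
by rewrite /= g0 g1 g2; apply: Do.
Qed.

Lemma iso_aut :
  exists2 f : flag M -> flag N, bijective f & map_morphism f /\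
    forall a, a \in map_aut M ->
      exists2 b, b \in map_aut N & forall x, b (f x) = f (a x).
Proof.
case: isoMN => f [[g fK gK] mf]; exists f; [by exists g | split=> //].
move=> a Ga; have mg := map_morphism_inv fK gK mf.
have injfag : injective (f \o (a \o g)).
  by apply: inj_comp (can_inj fK) _; apply: inj_comp perm_inj (can_inj gK).
have [|b Gb Db] := aut_of_morphism _ injfag.
  exact: map_morphism_comp mf (map_morphism_comp (autM Ga) mg).
by exists b => // x; rewrite Db /= fK.
Qed.

Lemma iso_regular : regular_map M -> regular_map N.
Proof.
move=> regM; have [f [g fK gK] [_ autN]] := iso_aut.
have /imsetP[x0 _ _] := regM; apply/(regularP (f x0)) => x y.
have [a Ga Dy] := (regularP x0).1 regM (g x) (g y); have [b Gb Db] := autN a Ga.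
by exists b; rewrite // -[x]gK Db -Dy gK.
Qed.

Lemma iso_edge_transitive : edge_transitive_map M -> edge_transitive_map N.
Proof.
move=> trM; have [f [g fK gK] [mf autN]] := iso_aut.
have /imsetP[_ /imsetP[x0 _ _] _] := trM.
apply/(edge_transitiveP (f x0)) => x y.
have [a Ga H] := (edge_transitiveP x0).1 trM (g x) (g y).
have [b Gb Db] := autN a Ga; exists b => //; rewrite -[x]gK Db -[y]gK.
have [f0 _ f2] := mf (a (g x)); have [f02 _ _] := mf (r2 (a (g x))).
by case/mem_edge: H => ->; rewrite edgeE ?f02 ?f0 ?f2 !inE eqxx /= ?orbT.
Qed.

End Morphisms.

(** * Cayley maps on complete graphs *)


Lemma next_nth_mod (T : eqType) (x0 : T) (s : seq T) i :
  uniq s -> i < size s -> next s (nth x0 s i) = nth x0 s (i.+1 %% size s).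
Proof.
case: s => // y s Us lt_i; rewrite next_nth mem_nth // index_uniq //.
move: lt_i; rewrite ltnS leq_eqVlt => /predU1P[->|lt_i].
  by rewrite nth_default // modnn.
by rewrite modn_small ?ltnS //=; apply: set_nth_default.
Qed.

Section CompleteCayley.

Variables (G : finZmodType) (s : seq G) (Hs : rotation_seq s).
Hypothesis s_full : forall x, x != 0%R -> x \in s.

Local Notation P := (petrie_dual (cayley_map Hs)).
Local Open Scope ring_scope.

(** [r1] and [r2] keep the first component; conversely, the rotation is a single cycle, so they lead
    through all directions at a vertex, on both sides. *)
Lemma cayley_vertex (f g : flag P) : vertex f = vertex g <-> f.1.1 = g.1.1.
Proof.
split; first by apply: (@vertex_ind P (fun z => f.1.1 = z.1.1)) => // - [[v x] b].
case: f g => [[v x] b] [[w y] b'] /= <-.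
have side u b1 b2 : vertex ((v, u, b1) : flag P) = vertex ((v, u, b2) : flag P).
  by case: b1 b2 => [] []; rewrite // -[LHS](@vertex_r2 P).
rewrite (side x _ true) (side y _ true).
have [Us _ _ _] := Hs.
have /iter_findex : fconnect (next s) (ssval x) (ssval y).
  by rewrite (fconnect_cycle (cycle_next Us) (ssvalP x)) ssvalP.
move: (findex _ _ _) => k; elim: k x => [|k IHk] x; first by move=> /val_inj->.
rewrite iterSr => /(IHk (SeqSub (rotation_nextP x))) <-.
by rewrite -[LHS](@vertex_r1 P); apply: side.
Qed.

Lemma petrie_cayley_embeds :
  (1 < #|G|)%N -> embeds_complete_graph P #|G|.
Proof.
move=> G_gt1; apply/embeds_complete_graphP.
have [x1 x1s] : exists x, x \in s.
  have /card_gt1P[x [y [_ _ nxy]]] : (1 < #|G|)%N by [].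
  by exists (x - y); apply: s_full; rewrite subr_eq0.
have [_ s0 _ _] := Hs.
have nz (x : seq_sub s) : ssval x <> 0 by move=> Dx; rewrite -Dx ssvalP in s0.
split.
- have /card_codom <- : injective (fun v => vertex ((v, SeqSub x1s, true) : flag P)).
    by move=> v w /(cayley_vertex (v, SeqSub x1s, true) (w, SeqSub x1s, true)).
  apply: eq_card => A; apply/imsetP/codomP => [[[[v x] b] _ ->]|[v ->]].
    by exists v; apply/cayley_vertex.
  by exists (v, SeqSub x1s, true).
- move=> [[v x] b] /cayley_vertex /=.
  by rewrite -{2}[v]addr0 => /addrI/nz.
- move=> [[v x] b] [[w y] b'] /cayley_vertex /= <-{w}.
  move=> /cayley_vertex /= /addrI /val_inj <-{y}.
  by case: b b' => [] []; [left|right|right|left].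
- move=> [[v x] b] [[w y] b'] nvw.
  have xy0 : w - v != 0.
    by rewrite subr_eq0 eq_sym; apply/eqP=> vw; apply/nvw/cayley_vertex.
  exists (v, SeqSub (s_full xy0), true); split; apply/cayley_vertex => //=.
  by rewrite addrC subrK.
Qed.

(** For an orientation [o], the value of [o f (+) f.2] depends only on the vertex of [f], and it
    changes along every edge because [r0] of the Petrie dual keeps the side. Three pairwise adjacent
    vertices cannot be 2-coloured in this way. *)
Lemma petrie_cayley_nonorientable : (2 < #|G|)%N -> ~ orientable P.
Proof.
move=> G_gt2 [o Do].
have inv (f g : flag P) : vertex f = vertex g -> o f (+) f.2 = o g (+) g.2.
  apply: (@vertex_ind P (fun z => o f (+) f.2 = o z (+) z.2)) => // z ->;
    have [_ o1 o2] := Do z; rewrite ?o1 ?o2; case: z {o1 o2} => [[v x] b] /=;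
    by rewrite addNb addbN negbK.
have step (f g : flag P) :
    f.1.1 != g.1.1 -> o g (+) g.2 = ~~ (o f (+) f.2).
  rewrite eq_sym -subr_eq0 => d0; have [f0 _ _] := Do (f.1.1, SeqSub (s_full d0), f.2).
  rewrite -(inv (f.1.1, SeqSub (s_full d0), f.2) f); last exact/cayley_vertex.
  rewrite -(inv (r0 ((f.1.1, SeqSub (s_full d0), f.2) : flag P)) g) ?f0.
    by rewrite /= negbK addNb.
  by apply/cayley_vertex; rewrite /= addrC subrK.
have /card_gt2P[x [y [z [_ [nxy nyz nzx]]]]] : (2 < #|G|)%N by [].
have d0 : x - y != 0 by rewrite subr_eq0.
pose u := SeqSub (s_full d0).
have := step (x, u, true) (y, u, true) nxy.
rewrite (step (z, u, true) (y, u, true)) 1?eq_sym //.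
rewrite (step (x, u, true) (z, u, true)) 1?eq_sym //.
by case: (o _ (+) _).
Qed.

End CompleteCayley.

(** * Affine automorphisms of Cayley maps over a field *)

Section CayleyField.

Variables (F : finFieldType) (s : seq F) (Hs : rotation_seq s).
Hypothesis s_full : forall x, x != 0%R -> x \in s.

Local Notation P := (petrie_dual (cayley_map Hs)).
Local Open Scope ring_scope.

Lemma direction_neq0 (x : seq_sub s) : ssval x != 0.
Proof.
by have [_ + _ _] := Hs; apply: contra => /eqP <-; apply: ssvalP.
Qed.

Definition respects_rotation (a : F) : Prop :=
  forall x, x != 0 -> next s (a * x) = a * next s x.

Lemma respects_rotation_prev a : a != 0 -> respects_rotation a ->
  forall x, x != 0 -> prev s (a * x) = a * prev s x.
Proof.
have [Us s0 _ _] := Hs.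
move=> a0 nexta x x0; have sx := s_full x0.
have px0 : prev s x != 0 by apply: contraNneq s0 => <-; rewrite mem_prev.
by rewrite -{1}[x](next_prev Us) -(nexta _ px0) prev_next.
Qed.

Lemma respects_rotationM a b : b != 0 ->
  respects_rotation a -> respects_rotation b -> respects_rotation (a * b).
Proof.
by move=> b0 Ra Rb x x0; rewrite -!mulrA Ra ?mulf_neq0 // Rb.
Qed.

Lemma respects_rotationX a i : a != 0 ->
  respects_rotation a -> respects_rotation (a ^+ i).
Proof.
move=> a0 Ra; elim: i => [|i IHi]; first by move=> x _; rewrite !mul1r.
by rewrite exprS; apply: respects_rotationM; rewrite ?expf_neq0.
Qed.

Lemma cayley_affine_aut a t : a != 0 -> respects_rotation a ->
  exists2 g, g \in map_aut P &
    forall f, (g f).1.1 = a * f.1.1 + t /\ ssval (g f).1.2 = a * ssval f.1.2.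
Proof.
move=> a0 Ra; have dirP (x : seq_sub s) : a * ssval x \in s.
  by rewrite s_full ?mulf_neq0 ?direction_neq0.
pose m (f : flag P) : flag P := (a * f.1.1 + t, SeqSub (dirP f.1.2), f.2).
have [|[[v x] b] [[w y] b'] [/addIr/(mulfI a0)-> /(mulfI a0)/val_inj-> ->] //|g Gg Dg] :=
  @aut_of_morphism P m; last by exists g => // f; rewrite Dg.
move=> [[v x] b]; split; rewrite /m //=.
  congr (_, _, _); first by rewrite mulrDr addrAC.
  by apply: val_inj; rewrite /= mulrN.
congr (_, _, _); apply: val_inj; have x0 := direction_neq0 x.
by case: b => /=; rewrite ?Ra ?respects_rotation_prev.
Qed.

Lemma petrie_cayley_edge_transitive :
    (forall x y, x != 0 -> y != 0 -> exists a,
       [/\ a != 0, respects_rotation a & a * x = y \/ a * x = - y]) ->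
  edge_transitive_map P.
Proof.
move=> trs; have f0 : flag P by exact: (0, SeqSub (s_full (oner_neq0 F)), true).
apply/(edge_transitiveP f0) => [[[v x] b] [[w y] b']].
have [a [a0 Ra [Dy|Dy]]] := trs _ _ (direction_neq0 x) (direction_neq0 y).
  have [g Gg Dg] := cayley_affine_aut (w - a * v) a0 Ra; exists g => //.
  have [] := Dg (v, x, b); case: (g _) => [[w' y'] b''] /=.
  rewrite addrC subrK Dy => -> /val_inj->.
  by rewrite edgeE !inE; case: b' b'' => [] []; rewrite !eqxx /= ?orbT.
(* Here the image is the target edge traversed from its other end, the vertex [w + ssval y]. *)
have [g Gg Dg] := cayley_affine_aut (w + ssval y - a * v) a0 Ra; exists g => //.
have [] := Dg (v, x, b); case: (g _) => [[w' y'] b''] /=.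
rewrite [_ + (_ - _)]addrC subrK Dy => -> Dy'.
suff: (w, y, b') \in edge (r0 ((w + ssval y, y', b'') : flag P)) by rewrite edge_r0.
have Dr0 : r0 ((w + ssval y, y', b'') : flag P) = (w, y, b'').
  rewrite /= /petrie_r0 /= negbK; congr (_, _, _); first by rewrite Dy' addrK.
  by apply: val_inj; rewrite /= Dy' opprK.
by rewrite Dr0 edgeE !inE; case: b' b'' {Dr0} => [] []; rewrite !eqxx /= ?orbT.
Qed.

(* A reflection fixing the flag at 0 towards 1 sends a^i to a^-i by its action
   on the rotation at 0, and 1 - a^i to 1 - a^-i by that on the rotation at 1. *)
Lemma petrie_cayley_regular a k i l :
    a != 0 -> (forall x, x != 0 -> iter k (next s) x = a * x) ->
    regular_map P ->
  1 - a ^+ i = a ^+ l -> 1 - a ^- i = a ^- l.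
Proof.
move=> a0 nextk regP; have [Us s0 _ _] := Hs.
pose f0 : flag P := (0, SeqSub (s_full (oner_neq0 F)), true).
have [g Gg /esym Gf0] := (regularP f0).1 regP f0 (r2 f0); have mg := autM Gg.
have g0 x : g (r0 x) = r0 (g x) by case: (mg x).
have g1 x : g (r1 x) = r1 (g x) by case: (mg x).
have g2 x : g (r2 x) = r2 (g x) by case: (mg x).
(* Turning around a vertex: [rho] follows [next] on one side of the edges and [prev] on the other.
   As [g] changes the side of [f0], it replaces powers of [a] by their inverses. *)
pose rho (x : flag P) := r2 (r1 x).
have grho m x : g (iter m rho x) = iter m rho (g x).
  by elim: m => //= m IHm; rewrite g2 g1 IHm.
have rhoE m (x : flag P) : [/\ (iter m rho x).1.1 = x.1.1, (iter m rho x).2 = x.2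
    & ssval (iter m rho x).1.2 = iter m (if x.2 then next s else prev s) (ssval x.1.2)].
  elim: m => //= m []; case: (iter m rho x) => [[v y] b] /= <- Db Dy.
  by rewrite /rho; case: b Db Dy => /= <- ->.
have nextX m x : x != 0 -> iter (k * m) (next s) x = a ^+ m * x.
  elim: m x => [|m IHm] x x0; first by rewrite muln0 mul1r.
  by rewrite mulnS addnC iterD nextk // IHm ?mulf_neq0 // mulrA -exprSr.
have prevX m x : x != 0 -> iter (k * m) (prev s) x = a ^- m * x.
  move=> x0; apply: (mulfI (expf_neq0 m a0)); rewrite mulVKf ?expf_neq0 //.
  have prev0 : iter (k * m) (prev s) x != 0.
    have := s_full x0; elim: (k * m)%N => [|j IHj] sx //.
    by apply: contraNneq s0 => <-; rewrite iterS mem_prev s_full ?IHj.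
  by rewrite -nextX //; elim: (k * m)%N {prev0} => // j IHj; rewrite iterSr iterS next_prev.
have at0 m : exists z : flag P, z.1.1 = a ^+ m /\ (g z).1.1 = a ^- m.
  exists (r0 (iter (k * m) rho f0)); rewrite g0 grho Gf0.
  have [] := rhoE (k * m)%N f0; have [] := rhoE (k * m)%N (r2 f0).
  case: (iter _ rho f0) => [[? ?] ?]; case: (iter _ rho (r2 f0)) => [[? ?] ?] /=.
  move=> -> _ -> -> _ ->.
  by rewrite nextX ?prevX ?oner_neq0 // !mulr1 !add0r.
have at1 m : exists z : flag P, z.1.1 = 1 - a ^+ m /\ (g z).1.1 = 1 - a ^- m.
  exists (r0 (iter (k * m) rho (r0 f0))); rewrite g0 grho g0 Gf0.
  have [] := rhoE (k * m)%N (r0 f0); have [] := rhoE (k * m)%N (r0 (r2 f0)).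
  case: (iter _ rho (r0 f0)) => [[? ?] ?].
  case: (iter _ rho (r0 (r2 f0))) => [[? ?] ?] /=.
  move=> -> _ -> -> _ ->.
  by rewrite nextX ?prevX ?oppr_eq0 ?oner_neq0 // !mulrN !mulr1 !add0r.
(* By hypothesis [1 - a ^+ i] and [a ^+ l] are the same vertex, so their images under [g]
   coincide. *)
move=> Dl; have [z [Dz <-]] := at1 i; have [t [Dt <-]] := at0 l.
apply/cayley_vertex/morphism_vertex; first exact: mg.
by apply/cayley_vertex; rewrite Dz Dt.
Qed.

End CayleyField.

(** * Biggs and James maps *)


Section PrimitiveElement.

Variables (F : finFieldType) (c : {unit F}).
Local Notation C := (FinRing.uval c).
Local Open Scope ring_scope.

Lemma prim_neq0 i : C ^+ i != 0.
Proof. by rewrite expf_neq0 // -unitfE (valP c). Qed.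

Lemma size_biggs : size (biggs_seq c) = #|F|.-1.
Proof. by rewrite size_map size_iota. Qed.

Lemma nth_biggs i : (i < #|F|.-1)%N -> nth 0 (biggs_seq c) i = C ^+ i.
Proof.
move=> lt_i; rewrite (nth_map 0%N) ?size_iota // nth_iota //.
exact: FinRing.val_unitX.
Qed.

Lemma size_james j : size (james_seq c j) = (#|F|.-1./2).*2.
Proof.
suff size_flat m a : size (flatten [seq [:: FinRing.uval (c ^+ (2 * i))%g;
    FinRing.uval (c ^+ (j + 2 * i))%g] | i <- iota a m]) = m.*2 by exact: size_flat.
by elim: m a => //= m IHm a; rewrite IHm.
Qed.

Lemma nth_james j k : (k < (#|F|.-1./2).*2)%N ->
  nth 0 (james_seq c j) k = C ^+ (odd k * j + k./2.*2).
Proof.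
have gen m a : (k < m.*2)%N ->
    nth 0 (flatten [seq [:: FinRing.uval (c ^+ (2 * i))%g;
                   FinRing.uval (c ^+ (j + 2 * i))%g] | i <- iota a m]) k
      = C ^+ (odd k * j + (a + k./2).*2).
  elim: m a k => // m IHm a [|[|k]] /=; rewrite doubleS ?ltnS.
  - by rewrite addn0 mul0n add0n mul2n FinRing.val_unitX.
  - by rewrite addn0 mul1n mul2n FinRing.val_unitX.
  by move/IHm->; rewrite negbK addSnnS.
by move/gen; apply.
Qed.

Hypothesis c_gen : generator [set: {unit F}] c.

Lemma card_finField_gt1 : (1 < #|F|)%N.
Proof.
by rewrite (cardD1 0) (cardD1 1) !inE oner_neq0.
Qed.

Lemma prim_eq i k : (C ^+ i == C ^+ k) = (i == k %[mod #|F|.-1])%N.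
Proof.
rewrite -(order_primitive c_gen) -eq_expg_mod_order -!FinRing.val_unitX.
by rewrite (inj_eq val_inj).
Qed.

Lemma prim_order : C ^+ #|F|.-1 = 1.
Proof. by apply/eqP; rewrite -(expr0 C) prim_eq modnn mod0n. Qed.

Lemma prim_exp x : x != 0 -> exists2 i, (i < #|F|.-1)%N & x = C ^+ i.
Proof.
case/(primitive_powerP c_gen) => i lt_i ->; exists i => //.
exact: FinRing.val_unitX.
Qed.

Lemma next_biggs x : x != 0 -> next (biggs_seq c) x = C * x.
Proof.
case/prim_exp=> i lt_i ->; have [Us _ _ _] := biggs_rotation c_gen.
have lt_i1 : (i.+1 %% #|F|.-1 < #|F|.-1)%N by rewrite ltn_mod; case: #|F|.-1 lt_i.
rewrite -exprS -(nth_biggs lt_i) next_nth_mod ?size_biggs // nth_biggs //.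
by apply/eqP; rewrite prim_eq modn_mod.
Qed.

Lemma biggs_full x : x != 0 -> x \in biggs_seq c.
Proof.
case/prim_exp=> i lt_i ->; rewrite -(nth_biggs lt_i).
by rewrite mem_nth // size_biggs.
Qed.

(** The rotation is multiplication by [C], which commutes with every multiplication. *)
Lemma petrie_biggs_edge_transitive :
  edge_transitive_map (petrie_dual (biggs_map c_gen)).
Proof.
apply: petrie_cayley_edge_transitive; first exact: biggs_full.
move=> x y x0 y0; exists (y / x); split; first by rewrite mulf_neq0 ?invr_neq0.
  have [i _ ->] := prim_exp (mulf_neq0 y0 (invr_neq0 x0)).
  by move=> z z0; rewrite !next_biggs ?mulf_neq0 ?prim_neq0 // mulrCA.
by left; rewrite divfK.
Qed.

(** For y = c^i different from 1, [petrie_cayley_regular] says that 1 - y^-1 is the inverse of 1 -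
    y, that is, y^2 - y + 1 = 0. The case i = 1 gives c^3 = -1, and then i = 2 gives 2 (1 - c) = 0.
    So c = 1 or c^3 = 1, although c has order at least 4. *)
Lemma petrie_biggs_nonregular :
  (5 <= #|F|)%N -> ~ regular_map (petrie_dual (biggs_map c_gen)).
Proof.
move=> F5 regP.
have C0 : C != 0 := prim_neq0 1.
have C1 i : (0 < i < 4)%N -> C ^+ i != 1.
  move=> lt_i; rewrite -(expr0 C) prim_eq.
  by rewrite mod0n modn_small; move: #|F| F5 lt_i; lia.
have refl i : (0 < i < 4)%N -> C ^+ i * C ^+ i - C ^+ i + 1 = 0.
  move=> lt_i; have nz : 1 - C ^+ i != 0 by rewrite subr_eq0 eq_sym C1.
  have [l _ Dl] := prim_exp nz.
  have next1 x : x != 0 -> iter 1 (next (biggs_seq c)) x = C * x by exact: next_biggs.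
  have := petrie_cayley_regular biggs_full C0 next1 regP Dl.
  rewrite -Dl; move: (C ^+ i) nz (prim_neq0 i) => y y1 y0 Dy.
  suff: (1 - y) * y * (1 - y^-1) = y.
    move=> Ey; transitivity (y - (1 - y) * y * (1 - y^-1)); first by field.
    by rewrite Ey subrr.
  by rewrite Dy; field.
have := refl 2 isT; have := refl 1 isT; rewrite !expr1 -[2]/(1 + 1)%N exprD expr1.
move=> E1 E2; have C3 : C ^+ 3 = -1.
  apply/eqP; rewrite -subr_eq0 opprK; apply/eqP.
  by rewrite -[RHS](mulr0 (C + 1)) -E1; ring.
have : (1 - C) * (1 + 1) = 0.
  transitivity (C * C * (C * C) - C * C + 1 - C * (C ^+ 3 + 1)
    + (C * C - C + 1)); last by rewrite E1 E2 C3; ring.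
  by ring.
move/eqP; rewrite mulf_eq0 subr_eq0 eq_sym -{1}[C]expr1 (negPf (C1 1%N _)) //=.
by rewrite addr_eq0 -C3 eq_sym (negPf (C1 3 _)).
Qed.

(** Over the field of order 4, squaring is additive and inverts c, so it reverses the rotation.
    Together with the change of side it is an automorphism reflecting the flag at 0 towards 1. This
    is what excludes n = 4 from the classification. *)
Lemma petrie_biggs_reflexible : #|F| = 4 ->
  exists2 g, g \in map_aut (petrie_dual (biggs_map c_gen)) &
    exists x, g x = r2 x.
Proof.
move=> F4; pose P := petrie_dual (biggs_map c_gen).
have [Us s0 _ _] := biggs_rotation c_gen.
have C3 : C ^+ 3 = 1 by have := prim_order; rewrite F4.
have nz (x : seq_sub (biggs_seq c)) : ssval x != 0.
  by apply: contraNneq s0 => <-; apply: ssvalP.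
have N1 : -1 = 1 :> F.
  have m1nz : -1 != 0 :> F by rewrite oppr_eq0 oner_neq0.
  have [i _ Di] := prim_exp m1nz.
  have : (-1 : F) ^+ 3 = 1 by rewrite Di -exprM mulnC exprM C3 expr1n.
  by rewrite exprS sqrrN expr1n mulr1.
have sqD (x y : F) : (x + y) ^+ 2 = x ^+ 2 + y ^+ 2.
  rewrite sqrrD; suff -> : x * y *+ 2 = 0 by rewrite addr0.
  by rewrite mulr2n -{2}[x * y]mul1r -N1 mulN1r subrr.
have sq_in (x : seq_sub (biggs_seq c)) : ssval x ^+ 2 \in biggs_seq c.
  by rewrite biggs_full ?expf_neq0.
pose f (z : flag P) : flag P := (z.1.1 ^+ 2, SeqSub (sq_in z.1.2), ~~ z.2).
have prev_biggs x : x != 0 -> prev (biggs_seq c) x = C ^+ 2 * x.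
  move=> x0; rewrite -{1}[x]mul1r -{1}C3 exprS -mulrA -next_biggs ?prev_next //.
  by rewrite mulf_neq0 ?prim_neq0.
have injf : injective f.
  move=> [[v x] b] [[w y] b'] [Dv Dx /negb_inj->].
  have sqI (p q : F) : p ^+ 2 = q ^+ 2 -> p = q.
    move=> /eqP; rewrite -subr_eq0 -[- _]mulN1r N1 mul1r -sqD sqrf_eq0.
    by rewrite addr_eq0 -[- q]mulN1r N1 mul1r => /eqP.
  by rewrite (sqI _ _ Dv); congr (_, _, _); apply/val_inj/sqI.
have [|g Gg Dg] := aut_of_morphism _ injf.
  move=> [[v x] b]; split; rewrite /f //=.
    congr (_, _, _); first exact: sqD.
    by apply: val_inj; rewrite /= sqrrN -[RHS]mulN1r N1 mul1r.
  congr (_, _, _); apply: val_inj => /=.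
  case: b => /=; first by rewrite next_biggs // prev_biggs ?expf_neq0 // exprMn.
  rewrite next_biggs ?expf_neq0 // prev_biggs // exprMn -exprM.
  by rewrite (exprD _ 3 1) C3 mul1r.
exists g => //; exists (0, SeqSub (biggs_full (oner_neq0 F)), true).
rewrite Dg /f /= expr0n; congr (_, _, _); apply: val_inj; exact: expr1n.
Qed.

End PrimitiveElement.

(** * A primitive element from a multiplier and one further direction *)

Section SignSpan.

Local Open Scope ring_scope.

(** Since -1 is not a power of g, the order Q of g is odd, and -g^((Q+1)/2) is a square root of g
    whose Q-th power is -1. As -1 = g^i s for some i, also s is minus a power of g; hence every
    nonzero element is a power of that root. *)
Lemma sign_span_generator (F : finFieldType) (g s : F) :
    g != 0 -> (forall i, g ^+ i != s) -> (forall i, g ^+ i != -1) ->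
    (forall x, x != 0 -> exists i, x = g ^+ i \/ x = g ^+ i * s) ->
  (#|F| %% 4)%N = 3%N /\ exists (c : {unit F}) j,
    [/\ generator [set: {unit F}] c, FinRing.uval c ^+ 2 = g, odd j,
        (j < #|F|.-1)%N & s = FinRing.uval c ^+ j].
Proof.
move=> g0 g_s g_N1 span.
have Ug : g \is a GRing.unit by rewrite unitfE.
pose u : {unit F} := FinRing.Unit Ug.
have gE i j : (g ^+ i == g ^+ j) = (i == j %[mod #[u]%g])%N.
  rewrite -eq_expg_mod_order -(inj_eq val_inj) /=.
  by rewrite !(FinRing.val_unitX _ u).
have gQ : g ^+ #[u]%g = 1 by apply/eqP; rewrite -(expr0 g) gE modnn mod0n.
have oddQ : odd #[u]%g.
  apply: contraLR isT => evenQ; set q := (#[u]%g)./2.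
  have Dq : q.*2 = #[u]%g by rewrite even_halfK.
  have /eqP : (g ^+ q) ^+ 2 = 1 by rewrite -exprM muln2 Dq.
  rewrite sqrf_eq1 (negPf (g_N1 q)) orbF -(expr0 g) gE mod0n modn_small.
    by have := order_gt0 u; rewrite -Dq; case: (q).
  by have := order_gt0 u; rewrite -Dq; case: (q) => // q' _; lia.
set Q := #[u]%g in gQ oddQ; pose C : F := - g ^+ (Q.+1)./2.
have C2 : C ^+ 2 = g.
  by rewrite sqrrN -exprM muln2 even_halfK /= ?oddQ // exprS gQ mulr1.
have CQ : C ^+ Q = -1.
  by rewrite exprNn -signr_odd oddQ expr1 -exprM mulnC exprM gQ expr1n mulr1.
have spanC x : x != 0 -> exists i, x = C ^+ i.
  have [i [//|D1]] : exists i, -1 = g ^+ i \/ -1 = g ^+ i * s.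
  - by apply: span; rewrite oppr_eq0 oner_neq0.
  - by move=> D1; case/eqP: (g_N1 i).
  (* The exponent i (Q - 1) stands for -i modulo Q. *)
  have Ds : s = - g ^+ (i * Q.-1).
    apply: (mulfI (expf_neq0 i g0)); rewrite -D1 mulrN -exprD -mulnS prednK.
      by rewrite mulnC exprM gQ expr1n.
    exact: odd_gt0.
  move=> x0; have [k [->|->]] := span x x0.
    by exists (2 * k)%N; rewrite exprM C2.
  exists (2 * k + Q + 2 * (i * Q.-1))%N.
  rewrite (exprD C (2 * k + Q)) (exprD C (2 * k)) 2!(exprM C 2) C2 CQ Ds.
  by rewrite mulrN1 mulNr mulrN.
have C0 : C != 0 by rewrite oppr_eq0 expf_neq0.
have UC : C \is a GRing.unit by rewrite unitfE.
pose c : {unit F} := FinRing.Unit UC.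
have cE : FinRing.uval c = C by [].
have c_gen : generator [set: {unit F}] c.
  rewrite /generator eqEsubset subsetT andbT; apply/subsetP=> w _.
  have [|i Dw] := spanC (FinRing.uval w); first by rewrite -unitfE (valP w).
  apply/cycleP; exists i; apply: val_inj; rewrite /= Dw.
  by rewrite (FinRing.val_unitX _ c).
have N1 : -1 != 1 :> F by rewrite -(expr0 g) eq_sym.
split.
  (* The order [#|F|.-1] of c divides 2 Q but not Q, and Q is odd; so it is twice an odd number. *)
  have CN := prim_eq c_gen; rewrite cE in CN.
  have : (#|F|.-1 %| 2 * Q)%N.
    rewrite /dvdn; have := CN (2 * Q)%N 0%N.
    by rewrite mod0n exprM C2 gQ eqxx => <-.
  have : ~~ (#|F|.-1 %| Q)%N.
    by rewrite /dvdn; have := CN Q 0%N; rewrite mod0n CQ => <-.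
  have := card_finField_gt1 F; move: #|F| => N N1' nQ /dvdnP[t Dt].
  have [odd_N|even_N] := boolP (odd N.-1).
    case/negP: nQ; rewrite -(@Gauss_dvdr _ 2) ?coprimen2 //.
    by apply/dvdnP; exists t.
  have odd_half : odd N.-1./2.
    apply: contraLR oddQ => even_w.
    have -> : Q = (t * N.-1./2)%N.
      by apply: double_inj; rewrite -mul2n Dt doubleMr even_halfK.
    by rewrite oddM (negPf even_w) andbF.
  by move: odd_half even_N N1'; lia.
have m1nz : -1 != 0 :> F by rewrite oppr_eq0 oner_neq0.
have s0 : s != 0.
  apply: contraTneq isT => s0; have [i [Di|]] := span (-1) m1nz.
    by have := g_N1 i; rewrite Di eqxx.
  by rewrite s0 mulr0 => /eqP; rewrite (negPf m1nz).
have [j lt_j Dj] := prim_exp c_gen s0; exists c, j; split=> //.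
(* For even j, s = c^j would be a power of g = c^2. *)
apply: contraT => even_j; have := g_s j./2.
by rewrite -C2 -exprM mul2n even_halfK // Dj eqxx.
Qed.

End SignSpan.

(** * Automorphisms of the James maps *)

Section JamesMaps.

Variables (F : finFieldType) (c : {unit F}).
Hypothesis c_gen : generator [set: {unit F}] c.
Hypothesis F3 : #|F| %% 4 = 3.
Local Notation C := (FinRing.uval c).
Local Open Scope ring_scope.

Let m := #|F|.-1./2.

Lemma card_james : #|F|.-1 = m.*2 /\ odd m.
Proof. by rewrite /m; move: #|F| F3; lia. Qed.

Lemma prim_half : C ^+ m = -1.
Proof.
have [DF odd_m] := card_james.
have /eqP: C ^+ m ^+ 2 = 1 by rewrite -exprM muln2 -DF (prim_order c_gen).
rewrite sqrf_eq1 => /orP[|/eqP //]; rewrite -(expr0 C) (prim_eq c_gen) DF.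
by rewrite mod0n modn_small ?(odd_gt0 odd_m) //; move: odd_m; lia.
Qed.

Lemma prim_parity i k : C ^+ i = C ^+ k -> odd i = odd k.
Proof.
move/eqP; rewrite (prim_eq c_gen) (proj1 card_james) => /eqP/(congr1 odd).
have oddm p : odd (p %% m.*2) = odd p.
  by rewrite {2}(divn_eq p m.*2) oddD oddM odd_double andbF.
by rewrite !oddm.
Qed.

Variables (j : nat) (odd_j : odd j).
Local Notation s := (james_seq c j).

Lemma james_full x : x != 0 -> x \in s.
Proof.
have full : s =i [pred x | x != 0].
  have [Us s0 _ _] := james_rotation c_gen F3 odd_j.
  have [DF _] := card_james.
  apply/subset_cardP; last by apply/subsetP=> y sy; apply: contraNneq s0 => <-.
  by rewrite (card_uniqP Us) size_james -DF -(cardC1 (0 : F)); apply: eq_card.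
by rewrite full.
Qed.

(** Two places further in the sequence, the exponent has grown by 2. At the end of the sequence the
    index drops by 2m and the exponent with it, which is harmless since c^(2m) = 1. *)
Lemma next_james x : x != 0 -> next s (next s x) = C ^+ 2 * x.
Proof.
have [Us _ _ _] := james_rotation c_gen F3 odd_j.
have [DF odd_m] := card_james; have m2 : (0 < m.*2)%N by move: odd_m; lia.
move/james_full/(nthP 0) => [k]; rewrite size_james -/m => lt_k <-.
do 2!rewrite next_nth_mod ?size_james ?ltn_mod //.
rewrite -[((_ %% _)%N).+1]addn1 modnDml addn1 !nth_james ?ltn_mod // -exprD.
apply/eqP; rewrite (prim_eq c_gen) DF ?doubleK.
have [lt_k2|le_k2] := ltnP k.+2 m.*2.
  rewrite (modn_small lt_k2) oddS oddS negbK.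
  by rewrite -[k.+2./2]/(k./2).+1 doubleS -[_.+2]add2n addnCA.
have -> : (k.+2 %% m.*2 = k.+2 - m.*2)%N.
  by rewrite -{1}(subnK le_k2) modnDr modn_small //; move: lt_k le_k2; lia.
have -> : odd (k.+2 - m.*2) = odd k.
  by rewrite oddB // odd_double /= negbK addbF.
rewrite -(modnDr (_ + _)) -addnA; apply/eqP; congr ((_ %% _)%N).
by rewrite [RHS]addnCA; congr (_ + _)%N; move: le_k2; lia.
Qed.

Lemma next_james_even i : next s (C ^+ i.*2) = C ^+ (j + i.*2).
Proof.
have [Us _ _ _] := james_rotation c_gen F3 odd_j.
have [DF odd_m] := card_james; have m0 := odd_gt0 odd_m.
have lt_i : (i %% m < m)%N by rewrite ltn_mod.
have Di : C ^+ i.*2 = nth 0 s (i %% m).*2.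
  rewrite nth_james -/m ?ltn_double // odd_double mul0n doubleK.
  by apply/eqP; rewrite (prim_eq c_gen) DF -!muln2 -!muln_modl modn_mod.
rewrite Di next_nth_mod ?size_james -/m ?ltn_double //.
rewrite modn_small; last by move: lt_i; lia.
rewrite nth_james -/m /= ?odd_double ?mul1n ?uphalf_double; last by move: lt_i; lia.
apply/eqP; rewrite (prim_eq c_gen) DF -!muln2 muln_modl.
by rewrite modnDmr.
Qed.

Lemma next_james_odd i : next s (C ^+ (j + i.*2)) = C ^+ i.+1.*2.
Proof.
by rewrite -next_james_even next_james ?prim_neq0 // -exprD.
Qed.

(** Multiplication by c^2 is the square of the rotation, hence commutes with it. *)
Lemma respects_rotation_square i : respects_rotation s (C ^+ i.*2).
Proof.
rewrite -mul2n exprM; apply: respects_rotationX; first exact: prim_neq0.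
move=> x x0; rewrite -!next_james //.
have [_ s0 _ _] := james_rotation c_gen F3 odd_j.
by apply: contraNneq s0 => <-; rewrite mem_next james_full.
Qed.

(** -1 = c^m with m odd is not a square, so one of y / x and -y / x is a square. *)
Lemma petrie_james_edge_transitive :
  edge_transitive_map (petrie_dual (james_map c_gen F3 odd_j)).
Proof.
have [DF odd_m] := card_james.
apply: petrie_cayley_edge_transitive; first exact: james_full.
move=> x y x0 y0; have [k _ Dk] := prim_exp c_gen (mulf_neq0 y0 (invr_neq0 x0)).
have [odd_k|even_k] := boolP (odd k).
  exists (C ^+ (k + m)./2.*2); split; first exact: prim_neq0.
    exact: respects_rotation_square.
  right; rewrite even_halfK ?oddD ?odd_k ?odd_m //.
  by rewrite exprD prim_half -Dk mulrN1 mulNr divfK.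
exists (C ^+ k./2.*2); split; first exact: prim_neq0.
  exact: respects_rotation_square.
by left; rewrite even_halfK // -Dk divfK.
Qed.

(** Only even powers of c are available as multipliers, so y^2 - y + 1 = 0 is obtained for some y
    such that y and 1 - y are both squares. It gives y^3 = -1, but -1 is not a square. *)
Lemma petrie_james_nonregular :
  (7 <= #|F|)%N -> ~ regular_map (petrie_dual (james_map c_gen F3 odd_j)).
Proof.
move=> F7 regP; have [DF odd_m] := card_james.
have C2 : C ^+ 2 != 1.
  rewrite -(expr0 C) (prim_eq c_gen) mod0n modn_small //.
  by move: #|F| F7; lia.
have a0 : C ^+ 2 != 0 := prim_neq0 c 2.
have next2 x : x != 0 -> iter 2 (next s) x = C ^+ 2 * x by exact: next_james.
(* One of 1 - c^2 and 1 - c^-2 is a square, as their quotient is -c^2. *)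
have [i [l Dl]] : exists i l, 1 - C ^+ 2 ^+ i = C ^+ 2 ^+ l.
  have nz : 1 - C ^+ 2 != 0 by rewrite subr_eq0 eq_sym.
  have [k _ Dk] := prim_exp c_gen nz.
  have [odd_k|even_k] := boolP (odd k); last first.
    by exists 1%N, k./2; rewrite expr1 Dk -exprM mul2n even_halfK.
  (* [m.-1] plays the role of -1 because c^(2m) = 1. Moreover 1 - c^-2 = -c^-2 (1 - c^2) = c^(k + m
     - 2), where k + m is even. *)
  exists m.-1, ((k + m)./2 + m.-1)%N; apply: (mulfI a0).
  rewrite mulrBr mulr1 -exprS prednK ?(odd_gt0 odd_m) // -!exprM -exprD.
  rewrite mul2n -DF (prim_order c_gen) mulnDr mul2n even_halfK; last first.
    by rewrite oddD odd_k odd_m.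
  rewrite addnCA -mulnS prednK ?(odd_gt0 odd_m) // mul2n -DF.
  by rewrite exprD (prim_order c_gen) mulr1 exprD prim_half -Dk mulrN1 opprB.
have := petrie_cayley_regular james_full a0 next2 regP Dl.
rewrite -Dl -exprM mul2n; set y := C ^+ i.*2 => Dy.
have y0 : y != 0 := prim_neq0 c _.
have y1 : 1 - y != 0 by rewrite /y -mul2n exprM Dl expf_neq0.
have Ey : (1 - y) * y * (1 - y^-1) = y by rewrite Dy; field.
have y3 : y ^+ 3 = -1.
  apply/eqP; rewrite -subr_eq0 opprK; apply/eqP.
  transitivity ((1 + y) * (y - (1 - y) * y * (1 - y^-1))); first by field.
  by rewrite Ey subrr mulr0.
have := prim_half; rewrite -y3 -exprM => /prim_parity.
by rewrite odd_m oddM odd_double.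
Qed.

End JamesMaps.

(** * A field from a cyclic group of automorphisms *)


Section AbelianZmodule.

Variables (gT : finGroupType) (K : {group gT}) (abelK : abelian K).

(** [K] written additively. The dummy let records [abelK] in the type, so that the structures below
    can be attached to it. *)
Definition abelian_zmod : Type := let _ := abelK in subg_of K.

HB.instance Definition _ := Finite.on abelian_zmod.

Local Notation V := abelian_zmod.

Fact abelian_addA : associative (fun x y : V => (x * y)%g : V).
Proof. by move=> x y z; rewrite mulgA. Qed.

Fact abelian_addC : commutative (fun x y : V => (x * y)%g : V).
Proof.
move=> x y; apply: val_inj; exact: (centsP abelK) (subgP x) _ (subgP y).
Qed.

Fact abelian_add0 : left_id (1%g : V) (fun x y : V => (x * y)%g : V).
Proof. exact: mul1g. Qed.

Fact abelian_addN :
  left_inverse (1%g : V) (fun x : V => (x^-1)%g : V) (fun x y : V => (x * y)%g : V).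
Proof. exact: mulVg. Qed.

HB.instance Definition _ := GRing.isZmodule.Build V
  abelian_addA abelian_addC abelian_add0 abelian_addN.

End AbelianZmodule.

Definition sign_opp (V : zmodType) (b : bool) (x : V) : V :=
  if b then (- x)%R else x.

Section CyclicField.

Local Open Scope ring_scope.

Variables (V : finZmodType) (phi : V -> V) (e : V).
Hypotheses (phiD : {morph phi : x y / x + y}) (phiI : injective phi).
Hypothesis e0 : e != 0.
Hypothesis phi_span :
  forall x, x != 0 -> exists p : nat * bool, x == sign_opp p.2 (iter p.1 phi e).

(** Again the dummy let makes the hypotheses parameters of the type that is to carry the field
    structure. *)
Definition cyclic_field : Type := let _ := (phiD, phiI, e0, phi_span) in V.

Local Notation F := cyclic_field.

HB.instance Definition _ := GRing.Zmodule.on F.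
HB.instance Definition _ := Finite.on F.

(* If x is the image of e under +/- phi^i, then x * y is that of y. *)
Definition cf_code (x : F) : nat * bool :=
  if insub x is Some u then xchoose (phi_span (valP (u : {x : V | x != 0})))
  else (0, false).

Definition cf_act (p : nat * bool) (x : F) : F := sign_opp p.2 (iter p.1 phi x).

Definition cf_mul (x y : F) : F := if x == 0 then 0 else cf_act (cf_code x) y.

Fact cf_codeP (x : F) : x != 0 -> cf_act (cf_code x) e = x.
Proof.
move=> x0; rewrite /cf_code insubT /=.
exact/esym/eqP/(xchooseP (phi_span (valP (exist (fun x => x != 0) x x0)))).
Qed.

Fact iter_phiD i : {morph iter i phi : x y / x + y}.
Proof. by elim: i => // i IHi x y; rewrite !iterS IHi phiD. Qed.

Fact cf_actD p : {morph cf_act p : x y / x + y}.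
Proof.
move=> x y; rewrite /cf_act iter_phiD; case: p.2 => //=; exact: opprD.
Qed.

Fact cf_act0 p : cf_act p 0 = 0.
Proof. by apply: (addrI (cf_act p 0)); rewrite -cf_actD !addr0. Qed.

Fact cf_actN p : {morph cf_act p : x / - x}.
Proof.
by move=> x; apply/eqP; rewrite -addr_eq0 -cf_actD addNr cf_act0.
Qed.

(** All these maps are signed powers of the one additive map [phi]. *)
Fact cf_actC p q x : cf_act p (cf_act q x) = cf_act q (cf_act p x).
Proof.
have actN (r : nat * bool) (b : bool) y :
    cf_act r (sign_opp b y) = sign_opp b (cf_act r y).
  by case: b; rewrite //= cf_actN.
rewrite {2}/cf_act {3}/cf_act !actN /cf_act.
rewrite -!iterD addnC; case: p.2 q.2 => [] [] //.
Qed.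

Fact cf_act_inj p : injective (cf_act p).
Proof.
move=> x y; rewrite /cf_act => Dxy.
have : iter p.1 phi x = iter p.1 phi y.
  by move: Dxy; case: p.2 => //; apply: oppr_inj.
by elim: p.1 => // i IHi; rewrite !iterS => /phiI.
Qed.

Fact cf_mulC : commutative cf_mul.
Proof.
move=> x y; rewrite /cf_mul; have [->|x0] := eqVneq x 0.
  by have [_|_] := eqVneq y 0; rewrite ?cf_act0.
have [->|y0] := eqVneq y 0; first by rewrite cf_act0.
by rewrite -{1}(cf_codeP y0) cf_actC cf_codeP.
Qed.

Fact cf_mulCA x y z : cf_mul x (cf_mul y z) = cf_mul y (cf_mul x z).
Proof.
rewrite /cf_mul; have [_|x0] := eqVneq x 0.
  by have [_|_] := eqVneq y 0; rewrite ?cf_act0.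
have [_|y0] := eqVneq y 0; first by rewrite cf_act0.
by rewrite cf_actC.
Qed.

(** Commutativity and left-commutativity suffice, so the code of a product is never compared with
    those of its factors. *)
Fact cf_mulA : associative cf_mul.
Proof. by move=> x y z; rewrite [cf_mul y z]cf_mulC cf_mulCA [cf_mul z _]cf_mulC. Qed.

Fact cf_mul1 : left_id (e : F) cf_mul.
Proof.
move=> x; rewrite cf_mulC /cf_mul; have [->//|x0] := eqVneq x 0.
exact: cf_codeP.
Qed.

Fact cf_mulDl : left_distributive cf_mul +%R.
Proof.
move=> x y z; rewrite ![cf_mul _ z]cf_mulC /cf_mul.
by have [_|_] := eqVneq z 0; rewrite ?addr0 ?cf_actD.
Qed.

HB.instance Definition _ := GRing.Zmodule_isComNzRing.Build F
  cf_mulA cf_mulC cf_mul1 cf_mulDl e0.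

Definition cf_inv (x : F) : F := if [pick y | x * y == 1] is Some y then y else 0.

(** The action of a code is injective on a finite type, hence it reaches 1. *)
Fact cf_mulV x : x != 0 -> cf_inv x * x = 1.
Proof.
move=> x0; rewrite /cf_inv; case: pickP => [y /eqP|no_inv].
  by rewrite mulrC.
have injx : injective (cf_act (cf_code x)) by apply: cf_act_inj.
have := no_inv (invF injx 1); rewrite -[X in X == _]/(cf_mul x _) /cf_mul.
by rewrite (negPf x0) f_invF eqxx.
Qed.

Fact cf_inv0 : cf_inv 0 = 0.
Proof.
rewrite /cf_inv; case: pickP => // y; rewrite mul0r eq_sym.
by rewrite (negPf (oner_neq0 _)).
Qed.

HB.instance Definition _ := GRing.ComNzRing_isField.Build F cf_mulV cf_inv0.

Lemma cyclic_fieldP : exists (E : finFieldType) (l : E -> V) (g : E),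
  [/\ bijective l, {morph l : x y / x + y}, l 1 = e
    & forall x, l (g * x) = phi (l x)].
Proof.
(* The action X with X e = x commutes with [phi], so x times [phi e] is X (phi e) = phi x. *)
exists (F : finFieldType), (fun x : F => x), (phi e); split=> //.
  by exists id.
move=> x; change (cf_mul (phi e) x = phi x); rewrite cf_mulC /cf_mul.
have [->|x0] := eqVneq x 0; first by rewrite -[phi 0]/(cf_act (1, false) 0) cf_act0.
by rewrite -[phi e]/(cf_act (1, false) e) cf_actC cf_codeP.
Qed.

End CyclicField.

Section ConjugationField.

Local Open Scope ring_scope.

(** This is [cyclic_fieldP] for [K] written additively, with conjugation by [h] as [phi]; the sign
    there is inversion here. *)
Lemma conjugation_field (gT : finGroupType) (K : {group gT}) (h k0 : gT) :
    abelian K -> h \in 'N(K)%g -> k0 \in K -> k0 != 1%g ->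
    (forall k, k \in K -> k != 1%g ->
       exists i, (k0 ^ (h ^+ i))%g = k \/ (k0 ^ (h ^+ i))%g = k^-1%g) ->
  exists (E : finFieldType) (l : E -> gT) (g : E),
    [/\ injective l /\ (forall k, k \in K -> exists x, l x = k),
        forall x, l x \in K, forall x y, l (x + y) = (l x * l y)%g,
        l 1 = k0 & forall x, l (g * x) = (l x ^ h)%g].
Proof.
move=> abelK nKh Kk0 k01 span; pose V := abelian_zmod abelK.
pose u (x : V) : gT := sgval x.
have Ku x : u x \in K := subgP x.
have uI : injective u := val_inj.
have uD x y : u (x + y) = (u x * u y)%g by [].
have uN x : u (- x) = (u x)^-1%g by [].
have u0 : u 0 = 1%g by [].
have usub k : k \in K -> u (subg K k : V) = k by exact: subgK.
pose phi (x : V) : V := subg K (u x ^ h).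
have uphi x : u (phi x) = (u x ^ h)%g by rewrite usub ?memJ_norm.
have uphiX i x : u (iter i phi x) = (u x ^ (h ^+ i))%g.
  by elim: i => [|i IHi]; rewrite ?conjg1 // iterS uphi IHi expgSr conjgM.
have phiD : {morph phi : x y / x + y}.
  by move=> x y; apply: uI; rewrite uD !uphi uD conjMg.
have phiI : injective phi.
  by move=> x y /(congr1 u); rewrite !uphi => /conjg_inj/uI.
pose e : V := subg K k0; have ue : u e = k0 by exact: usub.
have e0 : e != 0 by apply: contraNneq k01 => /(congr1 u); rewrite ue u0 => ->.
have [|E [l [g [[l' lK l'K] lD l1 lM]]]] := @cyclic_fieldP V phi e phiD phiI e0.
  move=> x x0; have [|i Di] := span (u x) (Ku x).
    by apply/eqP=> ux1; case/eqP: x0; apply: uI; rewrite ux1.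
  exists (i, if (k0 ^ (h ^+ i))%g == u x then false else true).
  rewrite /=; case: ifP => [/eqP Dk|/eqP nD]; apply/eqP; apply: uI => /=.
    by rewrite uphiX ue.
  by case: Di => // Di; apply: etrans (esym (uN _)); rewrite uphiX ue Di invgK.
exists E, (u \o l), g; split=> [|x|x y||x] /=.
- split; first exact: inj_comp uI (can_inj lK).
  by move=> k Kk; exists (l' (subg K k : V)); rewrite /= l'K usub.
- exact: Ku.
- by rewrite lD.
- by rewrite l1.
- by rewrite lM uphi.
Qed.

End ConjugationField.

(** * Orbits of flags *)


Section FlagOrbits.

Variable M : surface_map.
Implicit Types x y z : flag M.

Definition flag_orbit x : {set flag M} := orbit 'P (map_aut M) x.
Local Notation O := flag_orbit.

Lemma flag_orbitP x y : O x = O y <-> exists2 g, g \in map_aut M & y = g x.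
Proof.
split=> [Oxy|[g Gg ->]]; last by apply/esym/orbit_eqP/imsetP; exists g.
have /imsetP[g Gg Dy] : y \in O x by rewrite Oxy; apply: orbit_refl.
by exists g.
Qed.

Lemma flag_orbit_aut (g : {perm flag M}) x : g \in map_aut M -> O (g x) = O x.
Proof. by move=> Gg; apply/esym/flag_orbitP; exists g. Qed.

Lemma flag_orbit_r0 x y : O x = O y -> O (r0 x) = O (r0 y).
Proof.
case/flag_orbitP=> g Gg ->; apply/flag_orbitP; exists g => //.
by case: (autM Gg x).
Qed.

Lemma flag_orbit_r1 x y : O x = O y -> O (r1 x) = O (r1 y).
Proof.
case/flag_orbitP=> g Gg ->; apply/flag_orbitP; exists g => //.
by case: (autM Gg x).
Qed.

Lemma flag_orbit_r2 x y : O x = O y -> O (r2 x) = O (r2 y).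
Proof.
case/flag_orbitP=> g Gg ->; apply/flag_orbitP; exists g => //.
by case: (autM Gg x).
Qed.

Hypothesis r1_r2C : forall x, r1 (r2 x) = r2 (r1 x).

Lemma r2_aut : exists2 g, g \in map_aut M & g =1 @r2 M.
Proof.
by apply: aut_of_morphism (can_inj (@r2K M)) => x; rewrite r0_r2C r1_r2C.
Qed.

(* The automorphisms r2 and g1 with r1 x = g1 (r0 x) generate an abelian group
   A with at most the two orbits A x and A (r0 x), and a x |-> a^-1 (r0 x),
   a (r0 x) |-> a^-1 x is an automorphism. *)
Lemma r2_central_orbit_r0 x : O (r1 x) = O (r0 x) -> O (r0 x) = O x.
Proof.
move=> O10; have [//|nO] := eqVneq (O (r0 x)) (O x).
have [p Gp Dp] := r2_aut.
have Dp' z : (p^-1)%g z = r2 z by rewrite -{1}[z](@r2K M) -Dp permK.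
case/esym/flag_orbitP: O10 => g Gg Dg.
have Dg' : r1 (r0 x) = (g^-1)%g x.
  have [_ g1 _] := autM (groupVr Gg) (r1 x).
  by rewrite -[in RHS](r1K x) g1 Dg -permM mulgV perm1.
pose A := <<[set g; p]>>%G.
have pC h : h \in map_aut M -> commute h p.
  move=> Gh; apply/permP=> z; rewrite !permM !Dp.
  by case: (autM Gh z).
have abA : abelian A.
  rewrite abelian_gen abelianE; apply/subsetP=> a; rewrite !inE => aE.
  apply/centP=> b; rewrite !inE => /orP[]/eqP->; case/orP: aE => /eqP-> //.
    exact/commute_sym/pC.
  exact: pC.
have AC a b : a \in A -> b \in A -> (a * b = b * a)%g.
  by move=> Aa Ab; apply: (centsP abA).
have sAG : A \subset map_aut M.
  by rewrite gen_subG subUset !sub1set Gg.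
have Ag : g \in A by rewrite mem_gen // !inE eqxx.
have Ap : p \in A by rewrite mem_gen // !inE eqxx orbT.
(* The set of all a x and a (r0 x) is closed under [r1] because [r1] takes x to g (r0 x) and r0 x to
   g^-1 x. *)
have span z : exists2 a, a \in A & z = a x \/ z = a (r0 x).
  move: z; pose S z := exists2 a, a \in A & z = a x \/ z = a (r0 x).
  apply: (@flag_ind M S x) => [z|z|z|]; last by exists 1%g; rewrite ?perm1; auto.
  - case=> a Aa Dz; exists a => //; have Ga := subsetP sAG a Aa.
    have [a0 _ _] := autM Ga x; have [a00 _ _] := autM Ga (r0 x).
    by case: Dz => ->; [right; rewrite a0 | left; rewrite -a00 r0K].
  - case=> a Aa Dz; have Ga := subsetP sAG a Aa.
    have [_ a1 _] := autM Ga x; have [_ a01 _] := autM Ga (r0 x).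
    case: Dz => ->.
      by exists (g * a)%g; rewrite ?groupM //; right; rewrite permM -Dg a1.
    exists (g^-1 * a)%g; rewrite ?groupM ?groupV //; left.
    by rewrite permM -Dg' a01.
  - case=> a Aa Dz; exists (a * p)%g; first exact: groupM.
    by rewrite !permM !Dp; case: Dz => ->; [left|right].
(* By [nO] the two orbits of [A] are disjoint; as [A] also acts freely, every flag has a unique code
   in [A]. *)
have inj2 a b : a \in A -> b \in A -> a x <> b (r0 x).
  move=> /(subsetP sAG) Ga /(subsetP sAG) Gb Dab; case/eqP: nO.
  by rewrite -(flag_orbit_aut (r0 x) Gb) -Dab flag_orbit_aut.
have inj1 a b y : a \in A -> b \in A -> a y = b y -> a = b.
  move=> /(subsetP sAG) Ga /(subsetP sAG) Gb Dab; apply/eqP.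
  rewrite eq_mulgV1; apply/eqP/(@aut_free M _ y).
    by rewrite groupM ?groupV.
  by rewrite permM Dab permK.
have codeP z : exists a, (a \in A) && ((z == a x) || (z == a (r0 x))).
  by have [a Aa [->|->]] := span z; exists a; rewrite Aa eqxx ?orbT.
pose code z := xchoose (codeP z).
have codeA z : code z \in A by have /andP[] := xchooseP (codeP z).
have codex a : a \in A -> code (a x) = a.
  move=> Aa; have /andP[Ac /orP[/eqP|/eqP]] := xchooseP (codeP (a x)).
    by move/(inj1 _ _ _ Aa Ac)/esym.
  by move/(inj2 _ _ Aa Ac).
have codey a : a \in A -> code (a (r0 x)) = a.
  move=> Aa; have /andP[Ac /orP[/eqP|/eqP]] := xchooseP (codeP (a (r0 x))).
    by move/esym/(inj2 _ _ Ac Aa).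
  by move/(inj1 _ _ _ Aa Ac)/esym.
pose phi z := if z == code z x then (code z)^-1%g (r0 x) else (code z)^-1%g x.
have phix a : a \in A -> phi (a x) = a^-1%g (r0 x).
  by move=> Aa; rewrite /phi codex // eqxx.
have phiy a : a \in A -> phi (a (r0 x)) = a^-1%g x.
  move=> Aa; rewrite /phi codey // ifF //; apply/eqP=> /esym.
  exact: inj2.
have mphi : map_morphism phi.
  move=> z; have [a Aa Dz] := span z.
  have Ga := subsetP sAG a Aa; have Aa' := groupVr Aa; have Ga' := groupVr Ga.
  have [a0 a1 a2] := autM Ga x; have [a00 a01 a02] := autM Ga (r0 x).
  have [b0 b1 b2] := autM Ga' x; have [b00 b01 b02] := autM Ga' (r0 x).
  case: Dz => ->; split.
  - by rewrite -a0 phiy // phix // -b00 r0K.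
  - rewrite -a1 Dg -permM phiy ?groupM // phix // -b01 Dg' -permM.
    by rewrite -AC ?groupV ?groupM // -invMg AC.
  - by rewrite -Dp -permM phix ?groupM // (AC a) // invMg permM Dp' phix.
  - by rewrite -a00 r0K phix // phiy // -b0.
  - rewrite -a01 Dg' -permM phix ?groupM ?groupV // phiy // -b1 Dg -permM.
    by rewrite invMg invgK AC ?groupV.
  - by rewrite -Dp -permM phiy ?groupM // (AC a) // invMg permM Dp' phiy.
have phiK : cancel phi phi.
  move=> z; have [a Aa [->|->]] := span z.
    by rewrite phix // phiy ?groupV // invgK.
  by rewrite phiy // phix ?groupV // invgK.
have [f Gf Df] := aut_of_morphism mphi (can_inj phiK).
apply/esym/flag_orbitP; exists f => //.
by rewrite Df -{2}[x]perm1 phix ?group1 // invg1 perm1.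
Qed.

End FlagOrbits.

(** * How [r0], [r1] and [r2] permute the orbits of flags *)

Section EdgeTransitiveComplete.

Variables (M : surface_map) (n : nat).
Implicit Types x y z : flag M.
Local Notation O := (@flag_orbit M).
Local Notation G := (map_aut M).

Hypotheses (complete_M : complete_incidence M n) (nonorientable_M : ~ orientable M).
Hypotheses (nonregular_M : ~ regular_map M) (edge_transitive_M : edge_transitive_map M).

Lemma arc_unique x y :
  vertex x = vertex y -> vertex (r0 x) = vertex (r0 y) -> y = x \/ y = r2 x.
Proof. by case: complete_M => _ _ + _; apply. Qed.

Lemma loopless x : vertex (r0 x) <> vertex x.
Proof. by case: complete_M => _ + _ _; apply. Qed.

Lemma arc_exists x y : vertex x <> vertex y ->
  exists z, vertex z = vertex x /\ vertex (r0 z) = vertex y.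
Proof. by case: complete_M => _ _ _; apply. Qed.

(** By edge-transitivity the four flags of any one edge represent all orbits. *)
Lemma flag_orbit_edge x y :
  [\/ O y = O x, O y = O (r0 x), O y = O (r2 x) | O y = O (r0 (r2 x))].
Proof.
have [g Gg /mem_edge] := (edge_transitiveP x).1 edge_transitive_M x y.
have Ox := flag_orbit_aut x Gg.
by case=> ->; [apply: Or41 | apply: Or42 | apply: Or43 | apply: Or44];
  do ?[apply: flag_orbit_r0 | apply: flag_orbit_r2].
Qed.

Lemma flag_orbit_cosets x : ~ (O (r0 x) = O x /\ O (r2 x) = O x).
Proof.
case=> O0 O2; apply: nonregular_M; apply/(regularP x) => y z.
have Oall t : O t = O x.
  have [->|->|->|->] // := flag_orbit_edge x t.
  by rewrite (flag_orbit_r0 O2).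
by apply/flag_orbitP; rewrite !Oall.
Qed.

(** Every flag has the orbit of one of the four flags on the edge of x, and [r0] commutes with [r0]
    and [r2]. The next two lemmas hold for the same reason. *)
Lemma stable_r0 x y : O (r0 x) = O x -> O (r0 y) = O y.
Proof.
move=> O0; have O02 := flag_orbit_r2 O0.
have [Oy|Oy|Oy|Oy] := flag_orbit_edge x y; rewrite (flag_orbit_r0 Oy) Oy ?r0K //.
  by rewrite r0_r2C.
by rewrite r0_r2C.
Qed.

Lemma stable_r2 x y : O (r2 x) = O x -> O (r2 y) = O y.
Proof.
move=> O2; have O02 := flag_orbit_r0 O2.
by have [Oy|Oy|Oy|Oy] := flag_orbit_edge x y;
  rewrite (flag_orbit_r2 Oy) Oy ?r2_r0C ?r2K.
Qed.

Lemma stable_r0_r2 x y : O (r0 (r2 x)) = O x -> O (r0 (r2 y)) = O y.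
Proof.
move=> O02; have O0 := flag_orbit_r0 O02; have O2 := flag_orbit_r2 O02.
by have [Oy|Oy|Oy|Oy] := flag_orbit_edge x y;
  rewrite (flag_orbit_r0 (flag_orbit_r2 Oy)) Oy -?r0_r2C ?r2K ?r0K //;
  rewrite ?(r0K, r2_r0C, r2K) in O0 O2 *.
Qed.

(** [P] would be a proper 2-colouring of the vertices of a complete graph containing a triangle. *)
Lemma no_bipartition (P : flag M -> bool) : 2 < n ->
    (forall x, P (r1 x) = P x) -> (forall x, P (r2 x) = P x) ->
  (forall x, P (r0 x) = ~~ P x) -> False.
Proof.
case: complete_M => <- _ _ _ => n3 P1 P2 P0.
have inv x y : vertex x = vertex y -> P x = P y.
  by apply: (@vertex_ind M (fun z => P x = P z)) => // z ->; rewrite ?P1 ?P2.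
have step x y : vertex x != vertex y -> P y = ~~ P x.
  by move/eqP/arc_exists=> [z [/inv <- /inv <-]].
have /card_gt2P[A [B [D [[]]]]] := n3.
move=> /imsetP[x _ ->] /imsetP[y _ ->] /imsetP[z _ ->] [nxy nyz nzx].
by have := step _ _ nzx; rewrite (step _ _ nyz) (step _ _ nxy); case: (P x).
Qed.

(** If [r1] and [r2] commute at x, the vertex of x has at most four flags, hence at most two
    neighbours, and these with it are all the vertices. *)
Lemma r1_r2_distinct x : 3 < n -> r1 (r2 x) <> r2 (r1 x).
Proof.
case: complete_M => <- _ _ _ => n4 C12.
have at_x y : vertex x = vertex y ->
    [\/ y = x, y = r2 x, y = r1 x | y = r2 (r1 x)].
  pose S y := [\/ y = x, y = r2 x, y = r1 x | y = r2 (r1 x)].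
  apply: (@vertex_ind M S) => [z|z|]; last exact: Or41.
    case=> ->; rewrite ?r1K ?C12; [exact: Or43|exact: Or44|exact: Or41|].
    by rewrite -C12 r1K; apply: Or42.
  by case=> ->; rewrite ?r2K; [exact: Or42|exact: Or41|exact: Or44|exact: Or43].
suff: #|vertices M| <= 3 by rewrite leqNgt n4.
pose A := [set vertex x; vertex (r0 x)] :|: [set vertex (r0 (r1 x))].
have sVA : vertices M \subset A.
  apply/subsetP=> _ /imsetP[y _ ->]; rewrite !inE.
  have [//|/eqP nxy] := eqVneq (vertex y) (vertex x).
  have [z [/esym/at_x Dz <-]] := arc_exists (nesym nxy).
  by case: Dz => ->; rewrite ?vertex_r0_r2 eqxx ?orbT.
apply: leq_trans (subset_leq_card sVA) _.
apply: leq_trans (leq_card_setU _ _) _.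
by rewrite cards1 addn1 ltnS cards2; case: (_ == _).
Qed.

(** Otherwise x, [r1 x] and [r1 (r2 x)] lie on three different edges at one vertex, which gives four
    distinct vertices. *)
Lemma r1_r2_commute x : n <= 3 -> r1 (r2 x) = r2 (r1 x).
Proof.
case: complete_M => <- _ _ _ => n3; apply/eqP; apply: contraLR n3 => n12.
have n21 : r1 x != r2 x.
  by apply: contraNneq n12 => D; rewrite -D r1K D r2K.
rewrite -ltnNge.
pose A := [:: vertex x; vertex (r0 x); vertex (r0 (r1 x)); vertex (r0 (r1 (r2 x)))].
have UA : uniq A.
  rewrite /= !inE !negb_or !andbT -!andbA.
  do 5?[apply/andP; split]; apply/eqP.
  - by move/esym/loopless.
  - by rewrite -(vertex_r1 x) => /esym/loopless.
  - by rewrite -(vertex_r2 x) -(vertex_r1 (r2 x)) => /esym/loopless.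
  - move/(arc_unique (esym (vertex_r1 x)))=> [] /eqP.
      by rewrite (negPf (r1_free x)).
    by rewrite (negPf n21).
  - have Dv : vertex x = vertex (r1 (r2 x)) by rewrite vertex_r1 vertex_r2.
    move/(arc_unique Dv)=> [/(canRL (@r1K M))/eqP|/eqP].
      by rewrite eq_sym (negPf n21).
    by rewrite (negPf (r1_free _)).
  - have Dv : vertex (r1 x) = vertex (r1 (r2 x)).
      by rewrite !vertex_r1 vertex_r2.
    move/(arc_unique Dv)=> [/(can_inj (@r1K M))/eqP|/eqP]; first by rewrite (negPf (r2_free x)).
    by rewrite (negPf n12).
rewrite cardE; apply: (uniq_leq_size UA) => B; rewrite !inE mem_enum.
by case/or4P=> /eqP->; apply: vertex_in.
Qed.

(** For n at most 3, [r2] is itself an automorphism, so by non-regularity [r0] changes every orbit,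
    and [r1] preserves all orbits by [r2_central_orbit_r0]. If n = 3, the two orbits would 2-colour
    the vertices properly; if n is at most 2, then [r1 = r2] and [r0] is itself an automorphism. *)
Lemma order_gt3 : 3 < n.
Proof.
rewrite ltnNge; apply/negP=> n3; have C12 x := r1_r2_commute x n3.
have [p Gp Dp] := r2_aut C12.
have O2 x : O (r2 x) = O x by rewrite -Dp flag_orbit_aut.
have O0 x : O (r0 x) <> O x by move=> O0; apply: (@flag_orbit_cosets x).
have O1 x : O (r1 x) = O x.
  have [//|O10|->|O10] := flag_orbit_edge x (r1 x); last first.
  - case: (O0 x); apply: r2_central_orbit_r0 => //.
    by rewrite O10; apply: flag_orbit_r0.
  - exact: O2.
  - by case: (O0 x); apply: r2_central_orbit_r0.
have [x _|no_flag] := pickP {: flag M}; last first.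
  by apply: nonorientable_M; exists (fun=> true) => x; have := no_flag x.
have [n_gt2|n_le2] := ltnP 2 n.
  apply: (no_bipartition (P := fun y => O y == O x) n_gt2) => y.
  - by rewrite O1.
  - by rewrite O2.
  have [Oy|nOy] := eqVneq (O y) (O x).
    by apply/eqP=> O0y; apply: (O0 y); rewrite O0y.
  have O0y : O y = O (r0 x).
    have [Oy|//|Oy|->] := flag_orbit_edge x y.
    - by rewrite Oy eqxx in nOy.
    - by rewrite Oy O2 eqxx in nOy.
    - exact/flag_orbit_r0/O2.
  by rewrite (flag_orbit_r0 O0y) r0K eqxx.
have r12 y : r1 y = r2 y.
  have [Dv|nv] := eqVneq (vertex (r0 y)) (vertex (r0 (r1 y))).
    have [/eqP|//] := arc_unique (esym (vertex_r1 y)) Dv.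
    by rewrite (negPf (r1_free y)).
  suff: 2 < #|vertices M| by case: complete_M => -> _ _ _; rewrite ltnNge n_le2.
  apply/card_gt2P; exists (vertex y), (vertex (r0 y)), (vertex (r0 (r1 y))).
  split; first by rewrite !vertex_in.
  split=> //; apply/eqP; first by move/esym/loopless.
  by rewrite -(vertex_r1 y); apply: loopless.
have [|f Gf Df] := @aut_of_morphism M (@r0 M) _ (can_inj (@r0K M)).
  by move=> y; rewrite !r12 r0_r2C.
by apply: (O0 x); rewrite -Df flag_orbit_aut.
Qed.

(** An automorphism g with g x = r2 x is an involution. If it moved a vertex z, it would reverse the
    arc from z to its image, so that [r0] as well as [r2] would preserve orbits and the map would be
    regular. So g fixes all vertices and agrees with [r2] around the vertex of x, where [r1] and
    [r2] then commute. *)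
Lemma flag_orbit_r2_neq x : O (r2 x) <> O x.
Proof.
move=> /esym/flag_orbitP[g Gg Dg].
have gg : (g * g = 1)%g.
  apply: (@aut_free M _ x); first exact: groupM.
  by rewrite permM -Dg; case: (autM Gg x) => _ _ ->; rewrite -Dg r2K.
have ggE z : g (g z) = z by rewrite -permM gg perm1.
have O2 : O (r2 x) = O x by rewrite Dg flag_orbit_aut.
have fixV z : vertex (g z) = vertex z.
  apply/eqP/negPn/negP=> /eqP/nesym/arc_exists[y [Dz Dgz]].
  have [g0 _ _] := autM Gg y.
  have Dgy : vertex (r0 y) = vertex (g y) by rewrite Dgz; apply/aut_vertex.
  have Dg0 : vertex (r0 (r0 y)) = vertex (r0 (g y)).
    by rewrite r0K -g0 Dz -[z in LHS]ggE; apply/esym/aut_vertex.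
  apply: (@flag_orbit_cosets y); split; last exact: stable_r2 O2.
  have [Dy|Dy] := arc_unique Dgy Dg0; rewrite -(flag_orbit_aut y Gg) Dy //.
  by apply/esym; rewrite (stable_r2 _ O2).
have g2 y : vertex y = vertex x -> g y = r2 y.
  move=> _; have [g0 _ _] := autM Gg y.
  have [||g1|//] := @arc_unique y (g y); rewrite -?g0 ?fixV //.
  have g_1 := aut_free Gg g1; have := r2_free x.
  by rewrite Dg g_1 perm1 eqxx.
apply: (r1_r2_distinct (x := x) order_gt3); have [_ g1 _] := autM Gg x.
by rewrite -(g2 x) // -g1 g2 ?vertex_r1.
Qed.

Lemma arc_stabilizer (g : {perm flag M}) x : g \in G ->
  vertex (g x) = vertex x -> vertex (g (r0 x)) = vertex (r0 x) -> g = 1%g.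
Proof.
move=> Gg Dv Dw; have [g0 _ _] := autM Gg x.
have [||g1|g2] := @arc_unique x (g x); rewrite -?g0 ?Dv ?Dw //.
  exact: aut_free g1.
by case: (@flag_orbit_r2_neq x); rewrite -g2 flag_orbit_aut.
Qed.

(** By [arc_stabilizer] a nontrivial involution moves some vertex z; it then reverses the arc y from
    z to its image, so that g y is [r0 y] or [r0 (r2 y)] up to the order of [r0] and [r2]. *)
Lemma aut_involution (g : {perm flag M}) : g \in G -> g != 1%g -> (g * g = 1)%g ->
  (forall x, O (r0 x) = O x) \/ (forall x, O (r0 (r2 x)) = O x).
Proof.
move=> Gg g1 gg; have ggE z : g (g z) = z by rewrite -permM gg perm1.
have /existsP[z nz] : [exists z, vertex (g z) != vertex z].
  rewrite -negb_forall; apply: contra g1 => /forallP fixV.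
  have [x _|no_flag] := pickP {: flag M}; last first.
    by apply/eqP/permP=> x; have := no_flag x.
  by apply/eqP/(@arc_stabilizer _ x) => //; apply/eqP.
have [y [Dz Dgz]] := arc_exists (nesym (elimN eqP nz)).
have [g0 _ _] := autM Gg y.
have Dgy : vertex (r0 y) = vertex (g y) by rewrite Dgz; apply/aut_vertex.
have Dg0 : vertex (r0 (r0 y)) = vertex (r0 (g y)).
  by rewrite r0K -g0 Dz -[z in LHS]ggE; apply/esym/aut_vertex.
have [Dy|Dy] := arc_unique Dgy Dg0; [left|right] => x.
  by apply: (@stable_r0 y); rewrite -Dy flag_orbit_aut.
by apply: (@stable_r0_r2 y); rewrite r0_r2C -Dy flag_orbit_aut.
Qed.

(** A multi-rule with each inequality in both directions, by which colourings made of orbits are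
    evaluated. *)
Lemma four_orbits_neq x :
    (forall y, O (r0 y) <> O y) -> (forall y, O (r0 (r2 y)) <> O y) ->
  (((O x == O (r0 x)) = false) * ((O x == O (r2 x)) = false) *
   ((O x == O (r0 (r2 x))) = false) * ((O (r0 x) == O (r2 x)) = false) *
   ((O (r0 x) == O (r0 (r2 x))) = false) *
   ((O (r2 x) == O (r0 (r2 x))) = false)) *
  (((O (r0 x) == O x) = false) * ((O (r2 x) == O x) = false) *
   ((O (r0 (r2 x)) == O x) = false) * ((O (r2 x) == O (r0 x)) = false) *
   ((O (r0 (r2 x)) == O (r0 x)) = false) *
   ((O (r0 (r2 x)) == O (r2 x)) = false)).
Proof.
move=> n0 n02; have n2 := flag_orbit_r2_neq.
have n_r0_r2 y : O (r0 y) <> O (r2 y).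
  by move/flag_orbit_r2; rewrite r2K r2_r0C; apply: n02.
have n_r0_r02 y : O (r0 y) <> O (r0 (r2 y)).
  by move/flag_orbit_r0; rewrite !r0K; apply/nesym/n2.
by do !split; apply/eqP; auto; apply/nesym; auto.
Qed.

(** There are two orbits if [r0] or [r0 r2] preserves orbits, and four otherwise. In each case the
    action of [r1] on the orbits is compared with that of [r0] and [r2]; the combinations missing
    here give an orientation or a bipartition. *)
Lemma flag_orbit_cases :
  [\/ (forall x, O (r0 x) = O x) /\ (forall x, O (r1 x) = O (r2 x)),
      (forall x, O (r0 x) <> O x) /\ (forall x, O (r0 (r2 x)) <> O x) /\
        (forall x, O (r1 x) = O (r0 (r2 x)))
    | forall x, O (r1 x) = O x].
Proof.
have [x _|no_flag] := pickP {: flag M}; last first.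
  by apply: Or31; split=> x; have := no_flag x.
have n2 := flag_orbit_r2_neq.
have two_orbits : (forall y, O (r0 y) = O y) \/ (forall y, O (r0 (r2 y)) = O y) ->
    forall y z, O z = O y \/ O z = O (r2 y).
  case=> O0 y z; have [->|->|->|->] := flag_orbit_edge y z; auto.
  by right; rewrite -[in LHS](r2K y) O0.
have flip (P := fun y => O y == O x) : (forall y z, O z = O y \/ O z = O (r2 y)) ->
    forall y z, O z = O (r2 y) -> P z = ~~ P y.
  move=> two y z Oz; rewrite /P; have [Oy|Oy] := two x y.
    by rewrite Oz Oy eqxx; apply/eqP; rewrite (flag_orbit_r2 Oy); apply: n2.
  by rewrite Oz Oy (flag_orbit_r2 Oy) r2K eqxx; apply/esym/eqP/n2.
have two_cases : (forall y, O (r0 y) = O y) \/ (forall y, O (r0 (r2 y)) = O y) ->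
    (forall y, O (r1 y) = O (r2 y)) \/ (forall y, O (r1 y) = O y).
  move=> /two_orbits two; have [O1|n1] := eqVneq (O (r1 x)) (O x).
    right=> y; have [Oy|Oy] := two x y; rewrite (flag_orbit_r1 Oy) Oy //.
    have [O12|//] := two x (r1 (r2 x)); case: (n2 x).
    by rewrite -O1 -(flag_orbit_r1 O12) r1K.
  left=> y; have [O1|//] := two y (r1 y); case/eqP: n1.
  have [Ox|Ox] := two y x; rewrite (flag_orbit_r1 Ox) Ox //.
  have [O12|//] := two y (r1 (r2 y)); case: (n2 y).
  by rewrite -O1 -(flag_orbit_r1 O12) r1K.
have [O0|n0] := eqVneq (O (r0 x)) (O x).
  have O0' y := stable_r0 y O0.
  by have [O1|O1] := two_cases (or_introl O0'); [apply: Or31|apply: Or33].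
have [O02|n02] := eqVneq (O (r0 (r2 x))) (O x).
  have O02' y := stable_r0_r2 y O02; have two := two_orbits (or_intror O02').
  have [O1|O1] := two_cases (or_intror O02'); last exact: Or33.
  (* Here [r0], [r1] and [r2] all exchange the two orbits. *)
  case: nonorientable_M; exists (fun y => O y == O x) => y.
  by split; apply: (flip two) => //; rewrite -[in LHS](r2K y) O02'.
apply: Or32; have {}n0 y : O (r0 y) <> O y by move/(stable_r0 x); apply/eqP.
have {}n02 y : O (r0 (r2 y)) <> O y by move/(stable_r0_r2 x); apply/eqP.
split=> //; split=> //.
(* An automorphism taking y to [r1 y] is an involution, so [aut_involution] would leave only two
   orbits. *)
have n1 y : O (r1 y) <> O y.
  move=> /esym/flag_orbitP[g Gg Dg]; have [_ g1 _] := autM Gg y.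
  have [||O0|O02] := aut_involution Gg.
  - by apply: contraNneq (r1_free y) => g_1; rewrite Dg g_1 perm1.
  - by apply: (@aut_free M _ y); rewrite ?groupM // permM -Dg g1 -Dg r1K.
  - exact: (n0 y).
  - exact: (n02 y).
(* [r1] permutes the four orbits without fixed points, so if it exchanges two of them, it exchanges
   the other two. *)
have pair p q p' q' :
    (forall y, [\/ O y = O p, O y = O q, O y = O p' | O y = O q']) ->
    O p <> O p' -> O q <> O p' -> O (r1 p) = O q ->
  [/\ O (r1 q) = O p, O (r1 p') = O q' & O (r1 q') = O p'].
  move=> all4 npp' nqp' O1; have O1' : O (r1 q) = O p.
    by rewrite -(flag_orbit_r1 O1) r1K.
  suff O2 : O (r1 p') = O q'.
    by split=> //; rewrite -(flag_orbit_r1 O2) r1K.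
  have [O2|O2|/n1|] // := all4 (r1 p'); [case: nqp'|case: npp'].
    by rewrite -O1 -(flag_orbit_r1 O2) r1K.
  by rewrite -O1' -(flag_orbit_r1 O2) r1K.
have neqs := four_orbits_neq x n0 n02.
have [/n1 //|O1|O1|O1] := flag_orbit_edge x (r1 x).
- have [||Oq Op' Oq'] := pair x (r0 x) (r2 x) (r0 (r2 x)) (flag_orbit_edge x) _ _ O1.
  + by apply/eqP; rewrite neqs.
  + by apply/eqP; rewrite neqs.
  have O10 y : O (r1 y) = O (r0 y).
    by have [Oy|Oy|Oy|Oy] := flag_orbit_edge x y;
      rewrite (flag_orbit_r0 Oy) (flag_orbit_r1 Oy) ?r0K.
  (* If [r1] acts as [r0] on orbits, this union of two orbits is exchanged with its complement by
     all three involutions. *)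
  case: nonorientable_M; exists (fun y => (O y == O x) || (O y == O (r0 (r2 x)))).
  move=> y; rewrite O10; have [Oy|Oy|Oy|Oy] := flag_orbit_edge x y;
    by split; rewrite ?(flag_orbit_r0 Oy) ?(flag_orbit_r2 Oy) Oy
       ?r2_r0C ?r0K ?r2K ?eqxx ?neqs.
- have all4 y : [\/ O y = O x, O y = O (r2 x), O y = O (r0 x) | O y = O (r0 (r2 x))].
    by have [Oy|Oy|Oy|Oy] := flag_orbit_edge x y;
      [apply: Or41 | apply: Or43 | apply: Or42 | apply: Or44].
  have [||Oq Op' Oq'] := pair x (r2 x) (r0 x) (r0 (r2 x)) all4 _ _ O1.
  + by apply/eqP; rewrite neqs.
  + by apply/eqP; rewrite neqs.
  have O12 y : O (r1 y) = O (r2 y).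
    by have [Oy|Oy|Oy|Oy] := flag_orbit_edge x y;
      rewrite (flag_orbit_r2 Oy) (flag_orbit_r1 Oy) ?r2_r0C ?r2K.
  (* If [r1] acts as [r2], these two orbits form a set of flags that is a union of vertices and that
     [r0] exchanges with its complement. *)
  case: (no_bipartition (P := fun y => (O y == O x) || (O y == O (r2 x)))).
  + exact: ltnW order_gt3.
  + move=> y; rewrite O12; have [Oy|Oy|Oy|Oy] := flag_orbit_edge x y;
    by rewrite !(flag_orbit_r2 Oy) Oy ?r2_r0C ?r0K ?r2K ?eqxx ?neqs.
  + move=> y; have [Oy|Oy|Oy|Oy] := flag_orbit_edge x y;
    by rewrite !(flag_orbit_r2 Oy) Oy ?r2_r0C ?r0K ?r2K ?eqxx ?neqs.
  + move=> y; have [Oy|Oy|Oy|Oy] := flag_orbit_edge x y;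
    by rewrite !(flag_orbit_r0 Oy) Oy ?r2_r0C ?r0K ?r2K ?eqxx ?neqs.
- have all4 y : [\/ O y = O x, O y = O (r0 (r2 x)), O y = O (r0 x) | O y = O (r2 x)].
    by have [Oy|Oy|Oy|Oy] := flag_orbit_edge x y;
      [apply: Or41 | apply: Or43 | apply: Or44 | apply: Or42].
  have [||Oq Op' Oq' y] := pair x (r0 (r2 x)) (r0 x) (r2 x) all4 _ _ O1.
  + by apply/eqP; rewrite neqs.
  + by apply/eqP; rewrite neqs.
  by have [Oy|Oy|Oy|Oy] := flag_orbit_edge x y;
    rewrite !(flag_orbit_r0 (flag_orbit_r2 Oy)) (flag_orbit_r1 Oy)
            ?r2_r0C ?r0K ?r2K.
Qed.

End EdgeTransitiveComplete.

(** * The regular normal subgroup *)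


Section TranslationGroup.

Variables (M : surface_map) (n : nat).
Implicit Types x y z : flag M.
Local Notation O := (@flag_orbit M).

Hypotheses (complete_M : complete_incidence M n) (nonorientable_M : ~ orientable M).
Hypotheses (nonregular_M : ~ regular_map M) (edge_transitive_M : edge_transitive_map M).

Let cases := flag_orbit_cases complete_M nonorientable_M nonregular_M edge_transitive_M.
Let n_gt3 := order_gt3 complete_M nonorientable_M nonregular_M edge_transitive_M.
Let arc_stab := arc_stabilizer complete_M nonorientable_M nonregular_M edge_transitive_M.
Let involution :=
  aut_involution complete_M nonorientable_M nonregular_M edge_transitive_M.
Let r1_r2_neq x := @r1_r2_distinct M n complete_M x n_gt3.

Lemma r1_aut_involution (g : {perm flag M}) x :
  g \in map_aut M -> g x = r1 x -> g != 1%g /\ (g * g = 1)%g.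
Proof.
move=> Gg Dg; split.
  by apply: contraNneq (r1_free x) => g1; rewrite -Dg g1 perm1.
apply: (@aut_free M _ x); first exact: groupM.
by rewrite permM Dg; case: (autM Gg x) => _ -> _; rewrite Dg r1K.
Qed.

(** Adjacent vertices suffice. Where corners are reversed by automorphisms, these are involutions,
    to which [aut_involution] applies. *)
Lemma aut_vertex_transitive x y : exists2 g, g \in map_aut M & vertex (g x) = vertex y.
Proof.
have step z : exists2 g, g \in map_aut M & vertex (g z) = vertex (r0 z).
  have [[O0 _]|[_ [_ O1]]|O1] := cases.
  - by have /esym/flag_orbitP[g Gg ->] := O0 z; exists g.
  - have /flag_orbitP[g Gg Dg] := O1 z; exists g => //.
    by rewrite -vertex_r0_r2 Dg; apply/(aut_vertex _ _ Gg); rewrite vertex_r1.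
  have /esym/flag_orbitP[s Gs /esym Ds] := O1 z.
  have [s1 ss] := r1_aut_involution Gs Ds.
  have [O0|O02] := involution Gs s1 ss.
    by have /esym/flag_orbitP[g Gg ->] := O0 z; exists g.
  by have /esym/flag_orbitP[g Gg Dg] := O02 z; exists g; rewrite // -Dg vertex_r0_r2.
have [Dv|/eqP/(arc_exists complete_M)[z [Dz <-]]] := eqVneq (vertex x) (vertex y).
  by exists 1%g; rewrite ?perm1.
by have [g Gg <-] := step z; exists g => //; apply/aut_vertex.
Qed.

(** Another flag at the vertex lies in the orbit of x: the one after one or two steps of the
    rotation, or [r1 x], according to [flag_orbit_cases]. *)
Lemma stabilizer_nontrivial x :
  exists2 g, g \in map_aut M & g != 1%g /\ vertex (g x) = vertex x.
Proof.
suff [y [Oy nxy Dv]] : exists y, [/\ O x = O y, y <> x & vertex y = vertex x].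
  have /flag_orbitP[g Gg Dg] := Oy; exists g; rewrite // -Dg; split=> //.
  by apply/eqP=> g1; case: nxy; rewrite Dg g1 perm1.
have [[_ O1]|[_ [_ O1]]|O1] := cases.
- exists (r2 (r1 x)); split; last by rewrite vertex_r2 vertex_r1.
    by rewrite (flag_orbit_r2 (O1 x)) r2K.
  by move=> Dx; apply: (@r1_r2_neq x); rewrite -{1}Dx r2K r1K.
- exists (r2 (r1 (r2 (r1 x)))); split; last by rewrite !(vertex_r2, vertex_r1).
    have Orho y : O (r2 (r1 y)) = O (r0 y).
      by rewrite (flag_orbit_r2 (O1 y)) r2_r0C r2K.
    by rewrite Orho (flag_orbit_r0 (Orho x)) r0K.
  by move=> Dx; apply: (@r1_r2_neq x); rewrite -{1}Dx r2K r1K.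
- by exists (r1 x); split; [rewrite O1 | apply/eqP/r1_free | apply: vertex_r1].
Qed.

Lemma vertex_fixed (g : {perm flag M}) x :
  g \in map_aut M -> (vertex x \in afix ('P^*)%act [set g]) = (vertex (g x) == vertex x).
Proof. by move=> Gg; apply/afix1P/eqP; rewrite setact_vertex. Qed.

(** By [arc_stabilizer] only the identity fixes two vertices, so the action on vertices is a
    Frobenius action with complement [H], and Frobenius' theorem yields the kernel. *)
Lemma translation_group_exists x0 : exists K : {group {perm flag M}},
  [/\ (K <| map_aut M)%g, forall y, exists2 k, k \in K & vertex (k x0) = vertex y
    & forall k, k \in K -> vertex (k x0) = vertex x0 -> k = 1%g].
Proof.
pose H := [group of ('C_(map_aut M)[vertex x0 | 'P^*])%g].
have memH g : (g \in H) = (g \in map_aut M) && (vertex (g x0) == vertex x0).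
  rewrite inE; case Gg: (g \in map_aut M) => //=.
  by apply/astab1P/eqP; rewrite setact_vertex.
have actFrob : Frobenius_action (map_aut M) H (vertices M) 'P^*.
  split.
  - apply/subsetP=> g /setIP[Gg /astabP fixV]; apply/set1P.
    by apply: (arc_stab (x := x0)) => //;
      rewrite -[LHS]setact_vertex // fixV ?vertex_in.
  - apply/imsetP; exists (vertex x0); first exact: vertex_in.
    apply/setP=> A; apply/imsetP/imsetP=> [[y _ ->]|[g Gg ->]].
      have [g Gg Dv] := aut_vertex_transitive x0 y.
      by exists g; rewrite ?setact_vertex.
    by exists (g x0); rewrite ?setact_vertex.
  - move=> g /setD1P[g1 Gg]; rewrite leqNgt; apply: contraNN g1 => /card_gt1P.
    case=> [_ [_ [/setIP[/imsetP[x _ ->] +] /setIP[/imsetP[y _ ->] +] /eqP nxy]]].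
    rewrite !vertex_fixed // => /eqP gx /eqP gy.
    have [z [Dz Dw]] := arc_exists complete_M nxy.
    apply/eqP/(arc_stab (x := z)) => //.
      by rewrite Dz -gx; apply/aut_vertex.
    by rewrite Dw -gy; apply/aut_vertex.
  - have [g Gg [g1 gx0]] := stabilizer_nontrivial x0.
    apply: contraNneq g1 => H1; apply/eqP/set1gP; rewrite -H1 memH Gg gx0.
    exact: eqxx.
  - by exists (vertex x0); rewrite ?vertex_in.
have [K frobK] : {K : {group _} | [Frobenius map_aut M = K ><| H]%g}.
  apply: Frobenius_kernel_exists; apply/Frobenius_actionP.
  exact: hasFrobeniusAction actFrob.
have [defG _] := andP frobK; have [nsKG _ defKH nKH KH1] := sdprod_context (eqP defG).
exists K; split=> // [y|k Kk Dv].
  have [g] := aut_vertex_transitive x0 y.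
  (* Products of permutations act from left to right: in g = h k, the factor h fixes the vertex of
     [x0], so k alone takes it to that of y. *)
  rewrite -defKH -(normC nKH).
  case/mulsgP=> h k; rewrite memH => /andP[Gh /eqP hx0] Kk -> <-.
  exists k => //; rewrite permM; apply/aut_vertex; last by [].
  exact: subsetP (normal_sub nsKG) k Kk.
apply/set1gP; rewrite -KH1 inE Kk memH Dv eqxx andbT.
exact: subsetP (normal_sub nsKG) k Kk.
Qed.

Section Translations.

Variables (K : {group {perm flag M}}) (x0 : flag M).
Hypotheses (normalK : (K <| map_aut M)%g)
  (transK : forall y, exists2 k, k \in K & vertex (k x0) = vertex y)
  (freeK : forall k, k \in K -> vertex (k x0) = vertex x0 -> k = 1%g).

Let sKG := subsetP (normal_sub normalK).

Lemma translation_inj k k' :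
  k \in K -> k' \in K -> vertex (k x0) = vertex (k' x0) -> k = k'.
Proof.
move=> Kk Kk' Dv; apply/eqP; rewrite eq_mulgV1; apply/eqP/freeK.
  by rewrite groupM ?groupV.
rewrite permM -[x0 in RHS](permK k').
by apply/aut_vertex; rewrite ?groupV ?sKG.
Qed.

(** When [K] is identified with the set of vertices by its action on that of [x0], the stabilizer of
    this vertex acts by conjugation as it does on vertices. *)
Lemma translation_conj g k : g \in map_aut M -> vertex (g x0) = vertex x0 ->
  k \in K -> (k ^ g)%g \in K /\ vertex ((k ^ g)%g x0) = vertex (g (k x0)).
Proof.
move=> Gg Dv Kk; have KJ : (k ^ g)%g \in K.
  by rewrite memJ_norm // (subsetP (normal_norm normalK)).
split=> //; rewrite -[in RHS]permM [in RHS]conjgC [in RHS]permM.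
by apply/aut_vertex; [apply: sKG KJ | rewrite Dv].
Qed.

(** If g centralizes k, it also fixes the vertex of [k x0]. *)
Lemma stabilizer_semiregular g k : g \in map_aut M -> vertex (g x0) = vertex x0 ->
  k \in K -> k != 1%g -> (k ^ g)%g = k -> g = 1%g.
Proof.
move=> Gg Dv Kk k1 kg; have [_ Dw] := translation_conj Gg Dv Kk.
have nv : vertex x0 <> vertex (k x0).
  by move/esym/(freeK Kk)/eqP; rewrite (negPf k1).
have [z [Dz Dz']] := arc_exists complete_M nv; apply: (arc_stab (x := z)) => //.
  by rewrite Dz -Dv; apply/aut_vertex.
by rewrite Dz' -[in RHS]kg Dw; apply/aut_vertex.
Qed.

(** Some automorphism takes the edge from [x0] to [k x0] to that from [x0] to [k' x0]. If it
    reverses the direction, following it by k'^-1 takes [x0] back and [k x0] to the vertex of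
    k'^-1. *)
Lemma translations_fused k k' : k \in K -> k != 1%g -> k' \in K -> k' != 1%g ->
  exists2 g, g \in map_aut M &
    vertex (g x0) = vertex x0 /\ ((k ^ g)%g = k' \/ (k ^ g)%g = (k'^-1)%g).
Proof.
have nv j : j \in K -> j != 1%g -> vertex x0 <> vertex (j x0).
  by move=> Kj j1 /esym/(freeK Kj)/eqP; rewrite (negPf j1).
move=> Kk k1 Kk' k1'.
have [x [Dx Dx']] := arc_exists complete_M (nv k Kk k1).
have [y [Dy Dy']] := arc_exists complete_M (nv k' Kk' k1').
have [g Gg yE] := (edge_transitiveP x0).1 edge_transitive_M x y.
have [g0 _ _] := autM Gg x; have [g02 _ _] := autM Gg (r2 x).
have Dgx : vertex (g x) = vertex (g x0) by apply/aut_vertex.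
have Dgx' : vertex (r0 (g x)) = vertex (g (k x0)) by rewrite -g0; apply/aut_vertex.
have [[Ey Ey']|[Ey Ey']] : (vertex y = vertex (g x) /\ vertex (r0 y) = vertex (r0 (g x))) \/
    (vertex y = vertex (r0 (g x)) /\ vertex (r0 y) = vertex (g x)).
- case: (mem_edge yE) => ->; rewrite ?r0K ?vertex_r0_r2 ?vertex_r2; auto.
- have gx0 : vertex (g x0) = vertex x0 by rewrite -Dgx -Ey.
  exists g => //; split=> //; left; have [KJ DJ] := translation_conj Gg gx0 Kk.
  by apply: translation_inj; rewrite // DJ -Dgx' -Ey' Dy'.
have Gk' := sKG (groupVr Kk'); pose h := (g * k'^-1)%g.
have Gh : h \in map_aut M by rewrite groupM.
have hx0 : vertex (h x0) = vertex x0.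
  rewrite permM -[x0 in RHS](permK k'); apply/aut_vertex => //.
  by rewrite -Dgx -Ey' Dy'.
exists h => //; split=> //; right; have [KJ DJ] := translation_conj Gh hx0 Kk.
apply: translation_inj; rewrite ?groupV // DJ permM; apply/aut_vertex => //.
by rewrite -Dgx' -Ey.
Qed.

(** Fused elements have equal orders, so by Cauchy's theorem [K] is a p-group. Its centre is
    nontrivial and normal in the whole automorphism group, so by fusion it contains all of [K]. *)
Lemma translations_abelian : abelian K.
Proof.
have fuse k k' : k \in K -> k != 1%g -> k' \in K -> k' != 1%g ->
    exists2 g, g \in map_aut M & ((k ^ g)%g = k' \/ (k ^ g)%g = (k'^-1)%g).
  move=> Kk k1 Kk' k1'; have [g Gg [_ Dk]] := translations_fused Kk k1 Kk' k1'.
  by exists g.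
have [K1|ntK] := eqVneq K 1%G; first by rewrite K1 abelian1.
have cardK : 1 < #|K| by rewrite cardG_gt1; apply: contraNneq ntK => /group_inj->.
have p_pr := pdiv_prime cardK; set p := pdiv #|K| in p_pr.
have [k Kk ok] := Cauchy p_pr (pdiv_dvd _).
have k1 : k != 1%g by rewrite -order_gt1 ok prime_gt1.
have pK : (p.-group K)%g.
  rewrite /pgroup /pnat cardG_gt0; apply/allP=> q.
  rewrite mem_primes => /and3P[q_pr _ qK]; have [j Kj oj] := Cauchy q_pr qK.
  have j1 : j != 1%g by rewrite -order_gt1 oj prime_gt1.
  rewrite !inE -oj -ok; have [g _ [] Dj] := fuse _ _ Kk k1 Kj j1.
    by rewrite -Dj orderJ.
  by rewrite -[#[j]%g]orderV -Dj orderJ.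
have ntZ : ('Z(K) != 1)%g.
  rewrite (center_nil_eq1 (pgroup_nil pK)).
  by apply: contraNneq ntK => /group_inj->.
have [z Zz z1] := trivgPn _ ntZ; have Kz := subsetP (center_sub K) z Zz.
apply: abelianS (center_abelian K); apply/subsetP=> j Kj.
have [->|j1] := eqVneq j 1%g; first exact: group1.
have ZJ g : g \in map_aut M -> (z ^ g)%g \in ('Z(K))%g.
  move=> Gg; have nsZ := char_normal_trans (center_char K) normalK.
  by rewrite memJ_norm // (subsetP (normal_norm nsZ)).
have [g Gg [] Dj] := fuse _ _ Kz z1 Kj j1; first by rewrite -Dj ZJ.
by rewrite -groupV -Dj ZJ.
Qed.

(** The automorphisms s and t reversing the two corners at the edge of [x0] both invert [K]. So s t
    centralizes [K], whence s = t, and [r1] and [r2] commute at [x0]. *)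
Lemma r1_orbit_neq : ~ forall x, O (r1 x) = O x.
Proof.
move=> O1; have abK := centsP translations_abelian.
have flip x : vertex x = vertex x0 -> exists2 s, s \in map_aut M &
    [/\ s x = r1 x, vertex (s x0) = vertex x0, (s * s = 1)%g
       & forall k, k \in K -> k != 1%g -> (k ^ s)%g = k^-1%g].
  move=> Dv; have /esym/flag_orbitP[s Gs /esym Ds] := O1 x; exists s => //.
  have [s1 ss] := r1_aut_involution Gs Ds.
  have sx0 : vertex (s x0) = vertex x0.
    by rewrite -Dv -(vertex_r1 x) -Ds; apply/aut_vertex.
  split=> // k Kk k1; have [KJ _] := translation_conj Gs sx0 Kk.
  (* The product of k and its conjugate by s is fixed by s, since [K] is abelian; so it is
     trivial. *)
  apply/eqP; rewrite eq_sym eq_invg_mul; apply: contraNT s1 => kks1.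
  apply/eqP; apply: (stabilizer_semiregular Gs sx0 (groupM Kk KJ) kks1).
  by rewrite conjMg -conjgM ss conjg1 abK.
have [s Gs [Ds sx0 ss sK]] := flip x0 erefl.
have [t Gt [Dt tx0 tt tK]] := flip (r2 x0) (vertex_r2 _).
have [k Kk Dk] := transK (r0 x0).
have k1 : k != 1%g.
  apply/eqP=> k1; move: Dk; rewrite k1 perm1 => /esym.
  exact: loopless complete_M _.
have st1 : (s * t = 1)%g.
  apply: (@stabilizer_semiregular _ k) => //; first exact: groupM.
    by rewrite permM -[RHS]tx0; apply/aut_vertex.
  by rewrite conjgM sK // tK ?groupV ?eq_invg1 // invgK.
have Dst : s = t by rewrite -[t]mul1g -[1%g]ss -mulgA st1 mulg1.
apply: (@r1_r2_neq x0); rewrite -Dt -Dst.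
by have [_ _ ->] := autM Gs x0; rewrite Ds.
Qed.

End Translations.

End TranslationGroup.

(** * Coordinates *)


Section Coordinates.

Variables (M : surface_map) (n : nat) (x0 : flag M).
Implicit Types y z : flag M.
Hypothesis complete_M : complete_incidence M n.
Local Open Scope ring_scope.

Variables (F : finZmodType) (l : F -> {perm flag M}).
Hypotheses (l_aut : forall v, l v \in map_aut M)
  (lD : forall v w, l (v + w) = (l v * l w)%g)
  (l_trans : forall y, exists v, vertex (l v x0) = vertex y)
  (l_free : forall v w, vertex (l v x0) = vertex (l w x0) -> v = w).

Lemma translation0 : l 0 = 1%g.
Proof. by apply: (mulgI (l 0)); rewrite -lD addr0 mulg1. Qed.

(** The default 0 is never taken, by [l_trans]. *)
Definition pos y : F := odflt 0 [pick v | vertex (l v x0) == vertex y].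

Lemma posP y : vertex (l (pos y) x0) = vertex y.
Proof.
rewrite /pos; case: pickP => [v /eqP //|no_v].
by have [v /eqP] := l_trans y; rewrite no_v.
Qed.

Lemma pos_uniq v y : vertex (l v x0) = vertex y -> pos y = v.
Proof. by rewrite -(posP y) => /l_free. Qed.

Lemma pos_eq y z : pos y = pos z <-> vertex y = vertex z.
Proof.
by split=> [Dp|Dv]; [rewrite -(posP y) Dp posP | apply: pos_uniq; rewrite posP].
Qed.

Lemma pos_translate v y : pos (l v y) = pos y + v.
Proof.
by apply: pos_uniq; rewrite lD permM; apply/aut_vertex; rewrite ?l_aut ?posP.
Qed.

Definition dir y : F := pos (r0 y) - pos y.

Lemma dir_translate v y : dir (l v y) = dir y.
Proof.
rewrite /dir; have [<- _ _] := autM (l_aut v) y.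
by rewrite !pos_translate opprD addrACA subrr addr0.
Qed.

Lemma dir_neq0 y : dir y != 0.
Proof. by rewrite subr_eq0; apply/eqP=> /pos_eq/(loopless complete_M). Qed.

Lemma dir_r2 y : dir (r2 y) = dir y.
Proof.
by rewrite /dir; congr (_ - _); apply/pos_eq; rewrite ?vertex_r0_r2 ?vertex_r2.
Qed.

Lemma dir_r0 y : dir (r0 y) = - dir y.
Proof. by rewrite /dir r0K opprB. Qed.

Variable col : flag M -> bool.
Hypotheses (col0 : forall y, col (r0 y) = col y)
  (col1 : forall y, col (r1 y) = ~~ col y)
  (col2 : forall y, col (r2 y) = ~~ col y)
  (colG : forall g y, g \in map_aut M -> col (g y) = col y).

Lemma flag_uniq y z : pos y = pos z -> dir y = dir z -> col y = col z -> y = z.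
Proof.
move=> /[dup] Dp /pos_eq Dv Dd Dc.
have Dw : vertex (r0 y) = vertex (r0 z).
  by apply/pos_eq; move: Dd; rewrite /dir Dp => /addIr.
have [//|Dz] := arc_unique complete_M Dv Dw.
by move: Dc; rewrite Dz col2; case: (col y).
Qed.

Lemma dir_exists d : d != 0 ->
  exists y, [/\ vertex y = vertex x0, dir y = d & col y].
Proof.
move=> d0; have nv : vertex x0 <> vertex (l d x0).
  move/pos_eq; rewrite pos_translate -{1}[pos x0]addr0 => /addrI/esym/eqP.
  by rewrite (negPf d0).
have [z [Dz Dz']] := arc_exists complete_M nv.
have Dd : dir z = d.
  rewrite /dir (proj2 (pos_eq _ _) Dz) (proj2 (pos_eq _ _) Dz') pos_translate.
  by rewrite addrC addKr.
have [cz|ncz] := boolP (col z); first by exists z.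
by exists (r2 z); rewrite vertex_r2 dir_r2 col2 ncz.
Qed.

Variables (s : seq F) (Hs : rotation_seq s).
Hypothesis s_full : forall d, d != 0 -> d \in s.
Hypothesis dir_next : forall y, vertex y = vertex x0 -> col y ->
  dir (r2 (r1 y)) = next s (dir y).

(** Translations preserve [dir] and [col], so the rotation at the vertex of [x0] determines all
    others. *)
Lemma dir_next_all y : col y -> dir (r2 (r1 y)) = next s (dir y).
Proof.
move=> cy; pose z := l (- pos y) y.
have Dz : l (pos y) z = y.
  by apply: flag_uniq; rewrite ?dir_translate ?colG // !pos_translate subrK.
have := dir_next (y := z) _ _; rewrite -Dz.
have [_ l1 _] := autM (l_aut (pos y)) z.
have [_ _ l2] := autM (l_aut (pos y)) (r1 z).
rewrite -l1 -l2 !dir_translate; apply.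
  apply/pos_eq; rewrite pos_translate subrr; apply/esym/pos_uniq.
  by rewrite translation0 perm1.
by rewrite colG.
Qed.

Lemma dir_r1 y :
  dir (r1 y) = if col y then next s (dir y) else prev s (dir y).
Proof.
have [Us _ _ _] := Hs; have [cy|ncy] := boolP (col y).
  by rewrite -dir_next_all // dir_r2.
have := @dir_next_all (r1 y); rewrite col1 ncy r1K dir_r2 => -> //.
by rewrite prev_next.
Qed.

(** [pos], [dir] and [col] are the three components of a Cayley flag; [col] is unchanged by [r0], as
    is the side by [r0] of the Petrie dual. *)
Lemma coordinates_isomorphism : map_isomorphic M (petrie_dual (cayley_map Hs)).
Proof.
pose P := petrie_dual (cayley_map Hs).
pose f y : flag P := (pos y, SeqSub (s_full (dir_neq0 y)), col y).
have mf : map_morphism f.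
  move=> y; split; rewrite /f /=.
  - rewrite /petrie_r0 /= negbK col0; congr (_, _, _).
      by rewrite /dir addrC subrK.
    by apply: val_inj; rewrite /= dir_r0.
  - rewrite col1; congr (_, _, _); first exact/pos_eq/vertex_r1.
    by apply: val_inj; rewrite /= dir_r1; case: (col y).
  - rewrite col2; congr (_, _, _); first exact/pos_eq/vertex_r2.
    by apply: val_inj; rewrite /= dir_r2.
exists f; split=> //; apply: inj_card_bij.
  by move=> y z [Dp Dd Dc]; apply: flag_uniq.
(* The image is closed under the three involutions, hence everything by connectedness. *)
have surj p : exists y, f y == p.
  apply: (@flag_ind P (fun p => exists y, f y == p) (f x0)) p => [p|p|p|].
  - by case=> y /eqP<-; exists (r0 y); case: (mf y) => ->.
  - by case=> y /eqP<-; exists (r1 y); case: (mf y) => _ ->.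
  - by case=> y /eqP<-; exists (r2 y); case: (mf y) => _ _ ->.
  - by exists x0.
apply: leq_trans (leq_image_card f predT); apply/subset_leq_card/subsetP=> p _.
by have [y /eqP<-] := surj p; apply: codom_f.
Qed.

End Coordinates.

(** * Orientation of the Petrie dual and field coordinates *)

Section Classification.

Variables (M : surface_map) (n : nat) (x0 : flag M).
Implicit Types y z : flag M.
Local Notation O := (@flag_orbit M).

Hypotheses (complete_M : complete_incidence M n) (nonorientable_M : ~ orientable M).
Hypotheses (nonregular_M : ~ regular_map M) (edge_transitive_M : edge_transitive_map M).

Let r2_neq :=
  flag_orbit_r2_neq complete_M nonorientable_M nonregular_M edge_transitive_M.

Definition rotate y := r2 (r1 y).

(** An orientation of the Petrie dual of [M], invariant under automorphisms: [r0 r2], [r1] and [r2]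
    all reverse it. *)
Definition petrie_coloring (col : flag M -> bool) : Prop :=
  [/\ forall y, col (r0 y) = col y, forall y, col (r1 y) = ~~ col y,
      forall y, col (r2 y) = ~~ col y,
      forall g y, g \in map_aut M -> col (g y) = col y & col x0].

(** The orbits of [x0] and [r0 x0] form one colour class. The case of reversed corners is excluded
    by [r1_orbit_neq]. *)
Lemma petrie_coloring_exists : exists2 col, petrie_coloring col &
  (forall y, O (rotate y) = O y) \/
  [/\ forall y, O (rotate y) = O (r0 y), forall y, O (r0 y) <> O y
    & forall y, O (r0 (r2 y)) <> O y].
Proof.
pose col y := (O y == O x0) || (O y == O (r0 x0)).
have colG g y : g \in map_aut M -> col (g y) = col y.
  by move=> Gg; rewrite /col flag_orbit_aut.
have edge0 := flag_orbit_edge edge_transitive_M x0.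
have [[O0 O1]|[n0 [n02 O1]]|O1] :=
  flag_orbit_cases complete_M nonorientable_M nonregular_M edge_transitive_M.
- have two y : O y = O x0 \/ O y = O (r2 x0).
    by have [->|->|->|->] := edge0 y; rewrite ?O0; auto.
  have colE y : col y = (O y == O x0) by rewrite /col O0 orbb.
  have col2 y : col (r2 y) = ~~ col y.
    rewrite !colE; have [Oy|Oy] := two y; rewrite (flag_orbit_r2 Oy) Oy ?r2K eqxx.
      by apply/eqP; apply: r2_neq.
    by apply/esym/eqP; apply: r2_neq.
  exists col; last by left=> y; rewrite (flag_orbit_r2 (O1 y)) r2K.
  split=> // [y|y|]; last by rewrite colE eqxx.
    by rewrite !colE O0.
  by rewrite -col2 !colE O1.
- have neqs := four_orbits_neq complete_M nonorientable_M nonregular_M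
                 edge_transitive_M x0 n0 n02.
  exists col; last first.
    by right; split=> // y; rewrite (flag_orbit_r2 (O1 y)) r2_r0C r2K.
  split=> // [y|y|y|]; rewrite /col ?eqxx //; have [Oy|Oy|Oy|Oy] := edge0 y;
    by rewrite ?O1 ?(flag_orbit_r0 (flag_orbit_r2 Oy)) ?(flag_orbit_r0 Oy)
       ?(flag_orbit_r2 Oy) Oy ?r2_r0C ?r0K ?r2K ?eqxx ?neqs.
have [K [nsK transK freeK]] := translation_group_exists complete_M nonorientable_M
  nonregular_M edge_transitive_M x0.
by case: (r1_orbit_neq complete_M nonorientable_M nonregular_M edge_transitive_M
  nsK transK freeK).
Qed.

Variable col : flag M -> bool.
Hypothesis coloring : petrie_coloring col.

Lemma vertex_iter_rotate i y : vertex (iter i rotate y) = vertex y.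
Proof. by elim: i => //= i IHi; rewrite vertex_r2 vertex_r1. Qed.

Lemma aut_iter_rotate (g : {perm flag M}) i y :
  g \in map_aut M -> g (iter i rotate y) = iter i rotate (g y).
Proof.
move=> Gg; elim: i => //= i <-; rewrite /rotate.
have [_ <- _] := autM Gg (iter i rotate y).
by have [_ _ <-] := autM Gg (r1 (iter i rotate y)).
Qed.

(** The flags at a vertex are the iterates of one under [rotate] and their images under [r2]; the
    colour tells them apart. *)
Lemma vertex_rotation y :
  vertex y = vertex x0 -> col y -> exists i, y = iter i rotate x0.
Proof.
have [_ col1 col2 _ colx0] := coloring.
have injr : injective rotate.
  by move=> u v /(can_inj (@r2K M))/(can_inj (@r1K M)).
move=> /esym Dv cy.
suff: fconnect rotate x0 y \/ fconnect rotate x0 (r2 y).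
  case=> [/iter_findex <-|]; first by exists (findex rotate x0 y).
  move/iter_findex=> Dy; have: col (r2 y) = col x0.
    by rewrite -Dy; elim: (findex _ _ _) => //= i IHi; rewrite col2 col1 negbK.
  by rewrite col2 cy colx0.
pose S y := fconnect rotate x0 y \/ fconnect rotate x0 (r2 y).
apply: (@vertex_ind M S) Dv => [z|z|]; last by left; apply: connect0.
  case=> [zC|zC]; [right|left].
    by rewrite -/(rotate z) -(same_fconnect1_r injr).
  by rewrite (same_fconnect1_r injr) /rotate r1K.
by case=> zC; [right; rewrite r2K | left].
Qed.

Section Translations.

Variable K : {group {perm flag M}}.
Hypotheses (normalK : (K <| map_aut M)%g)
  (transK : forall y, exists2 k, k \in K & vertex (k x0) = vertex y)
  (freeK : forall k, k \in K -> vertex (k x0) = vertex x0 -> k = 1%g).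

Let abelK := translations_abelian complete_M edge_transitive_M normalK freeK.
Let sKG := subsetP (normal_sub normalK).
Let conjK := @translation_conj M K x0 normalK.

Local Open Scope ring_scope.

(** The stabilizer consists of powers of [h], so [translations_fused] gives the spanning hypothesis
    of [conjugation_field] with unit [k0]. By [translation_conj], [h] then multiplies positions and
    directions by [g]. *)
Lemma field_coordinates (h : {perm flag M}) (k0 : {perm flag M}) :
    h \in map_aut M -> vertex (h x0) = vertex x0 ->
    k0 \in K -> vertex (k0 x0) = vertex (r0 x0) ->
    (forall g, g \in map_aut M -> vertex (g x0) = vertex x0 ->
       exists i, g = (h ^+ i)%g) ->
  exists (F : finFieldType) (l : F -> {perm flag M}) (g : F),
    [/\ forall v, l v \in K, forall v w, l (v + w) = (l v * l w)%g,
        forall y, exists v, vertex (l v x0) = vertex y,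
        forall v w, vertex (l v x0) = vertex (l w x0) -> v = w &
        [/\ l 1 = k0, forall v, l (g * v) = (l v ^ h)%g,
            dir x0 l x0 = 1 & forall y, dir x0 l (h y) = g * dir x0 l y]].
Proof.
move=> Gh hx0 Kk0 Dk0 stabE.
have k01 : k0 != 1%g.
  apply/eqP=> k1; move: Dk0; rewrite k1 perm1 => /esym.
  exact: loopless complete_M _.
have span k : k \in K -> k != 1%g ->
    exists i, (k0 ^ (h ^+ i))%g = k \/ (k0 ^ (h ^+ i))%g = k^-1%g.
  move=> Kk k1; have [g Gg [gx0 Dk]] :=
    translations_fused complete_M edge_transitive_M normalK freeK Kk0 k01 Kk k1.
  by have [i Dg] := stabE g Gg gx0; exists i; rewrite -Dg.
have nKh : h \in 'N(K)%g := subsetP (normal_norm normalK) h Gh.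
have [F [l [g [[lI lK] Kl lD l1 lM]]]] := conjugation_field abelK nKh Kk0 k01 span.
have l_trans y : exists v, vertex (l v x0) = vertex y.
  by have [k Kk <-] := transK y; have [v <-] := lK k Kk; exists v.
have l_free v w : vertex (l v x0) = vertex (l w x0) -> v = w.
  by move/(translation_inj normalK freeK (Kl v) (Kl w))/lI.
have l_aut v : l v \in map_aut M by exact: sKG (Kl v).
exists F, l, g; split=> //; split=> //.
  rewrite /dir (pos_uniq (x0 := x0) l_trans l_free (v := 1)) ?l1 //.
  by rewrite (pos_uniq (x0 := x0) l_trans l_free (v := 0)) ?subr0 // (translation0 lD) perm1.
have pos_h y : pos x0 l (h y) = g * pos x0 l y.
  apply: pos_uniq => //; rewrite lM; have [_ ->] := conjK Gh hx0 (Kl (pos x0 l y)).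
  by apply/aut_vertex => //; apply: posP.
by move=> y; rewrite /dir mulrBr -!pos_h; have [-> _ _] := autM Gh y.
Qed.

End Translations.

End Classification.

(** * Recognizing Biggs and James maps *)


Section Recognition.

Variables (M : surface_map) (n : nat) (x0 : flag M).
Implicit Types y z : flag M.
Local Notation O := (@flag_orbit M).

Hypotheses (complete_M : complete_incidence M n) (nonorientable_M : ~ orientable M).
Hypotheses (nonregular_M : ~ regular_map M) (edge_transitive_M : edge_transitive_map M).

Let n_gt3 := order_gt3 complete_M nonorientable_M nonregular_M edge_transitive_M.
Let r2_neq :=
  flag_orbit_r2_neq complete_M nonorientable_M nonregular_M edge_transitive_M.

Local Notation rotate := (@rotate M).

Variable col : flag M -> bool.
Hypothesis coloring : petrie_coloring x0 col.

Variable K : {group {perm flag M}}.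
Hypotheses (normalK : (K <| map_aut M)%g)
  (transK : forall y, exists2 k, k \in K & vertex (k x0) = vertex y)
  (freeK : forall k, k \in K -> vertex (k x0) = vertex x0 -> k = 1%g).

Lemma card_of_isomorphism (F : finFieldType) (s : seq F) (Hs : rotation_seq s) :
    (forall x, x != 0%R -> x \in s) ->
    map_isomorphic M (petrie_dual (cayley_map Hs)) -> #|F| = n.
Proof.
move=> s_full iso; case: complete_M => <- _ _ _.
have /embeds_complete_graphP[] // := iso_embeds (map_isomorphic_sym iso)
  (petrie_cayley_embeds Hs s_full (card_finField_gt1 F)).
Qed.

Let stab_iter g : g \in map_aut M -> vertex (g x0) = vertex x0 ->
  exists i, g x0 = iter i rotate x0.
Proof.
have [_ _ _ colG colx0] := coloring.
by move=> Gg Dv; apply: (vertex_rotation coloring); rewrite ?colG.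
Qed.

Let aut_eq g h : g \in map_aut M -> h \in map_aut M -> g x0 = h x0 -> g = h.
Proof.
move=> Gg Gh Dgh; apply/permP.
exact: morphism_eq (autM Gg) (autM Gh) Dgh.
Qed.

Let expg_rotate d h i : h \in map_aut M -> h x0 = iter d rotate x0 ->
  (h ^+ i)%g x0 = iter (d * i) rotate x0.
Proof.
move=> Gh Dh; elim: i => [|i IHi]; first by rewrite muln0 perm1.
by rewrite expgSr permM IHi aut_iter_rotate // Dh -iterD mulnS addnC.
Qed.

Let dir_expg (F : finFieldType) (l : F -> {perm flag M}) (c : F)
    (h : {perm flag M}) i y :
    (forall z, dir x0 l (h z) = c * dir x0 l z)%R ->
  (dir x0 l ((h ^+ i)%g y) = c ^+ i * dir x0 l y)%R.
Proof.
move=> Dh; elim: i => [|i IHi]; first by rewrite perm1 mul1r.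
by rewrite expgSr permM Dh IHi exprS mulrA.
Qed.

Local Open Scope ring_scope.

(** Here [h] is one step of the rotation, so the direction after i steps is g^i. All nonzero
    directions occur at [x0], hence g is primitive. *)
Lemma recognize_biggs :
    (forall y, O (rotate y) = O y) ->
  exists (F : finFieldType) (c : {unit F}) (c_gen : generator [set: {unit F}] c),
    [/\ #|F| = n, (5 <= n)%N & map_isomorphic M (petrie_dual (biggs_map c_gen))].
Proof.
move=> Orot; have [col0 col1 col2 colG colx0] := coloring.
have /esym/flag_orbitP[h Gh /esym Dh] := Orot x0.
have hx0 : vertex (h x0) = vertex x0 by rewrite Dh vertex_r2 vertex_r1.
have [k0 Kk0 Dk0] := transK (r0 x0).
have stabE g : g \in map_aut M -> vertex (g x0) = vertex x0 ->
    exists i, g = (h ^+ i)%g.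
  move=> Gg /(stab_iter Gg)[i Di]; exists i; apply: aut_eq => //.
    exact: groupX.
  by rewrite (@expg_rotate 1) // mul1n.
have [F [l [g [Kl lD l_trans l_free [l1 lM dir1 dir_h]]]]] :=
  field_coordinates complete_M edge_transitive_M normalK transK freeK
    Gh hx0 Kk0 Dk0 stabE.
have l_aut v : l v \in map_aut M by apply: (subsetP (normal_sub normalK)) (Kl v).
have dirX i : dir x0 l (iter i rotate x0) = g ^+ i.
  rewrite -[i in iter i]mul1n -(@expg_rotate 1 h i Gh Dh) (@dir_expg F l g h _ _ dir_h).
  by rewrite dir1 mulr1.
have g0 : g != 0.
  by have := dir_neq0 complete_M l_trans l_free (h x0); rewrite dir_h dir1 mulr1.
have Ug : g \is a GRing.unit by rewrite unitfE.
pose c : {unit F} := FinRing.Unit Ug.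
have c_gen : generator [set: {unit F}] c.
  rewrite /generator eqEsubset subsetT andbT; apply/subsetP=> u _.
  have u0 : FinRing.uval u != 0 by rewrite -unitfE (valP u).
  have [y [Dv Dy cy]] := dir_exists complete_M l_aut lD l_trans l_free col2 u0.
  have [i Di] := vertex_rotation coloring Dv cy.
  apply/cycleP; exists i; apply: val_inj; rewrite /= -Dy Di dirX.
  by rewrite (FinRing.val_unitX _ c).
have iso : map_isomorphic M (petrie_dual (biggs_map c_gen)).
  apply: (@coordinates_isomorphism M n x0 complete_M _ l l_aut lD l_trans l_free
            col col0 col1 col2 colG _ (biggs_rotation c_gen) (biggs_full c_gen)).
  move=> y Dv cy; have [i ->] := vertex_rotation coloring Dv cy.
  rewrite -[r2 _]/(iter i.+1 rotate x0) !dirX next_biggs ?expf_neq0 //.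
  by rewrite exprS.
have Fn := card_of_isomorphism (biggs_full c_gen) iso.
exists F, c, c_gen; split=> //; rewrite ltn_neqAle n_gt3 andbT.
(* For n = 4 the Frobenius reflection contradicts [flag_orbit_r2_neq]. *)
apply/eqP=> n4; have [a Ga [z Dz]] := petrie_biggs_reflexible c_gen (etrans Fn (esym n4)).
have [f _ [mf autf]] := iso_aut (map_isomorphic_sym iso).
have [b Gb Db] := autf a Ga; apply: (@r2_neq (f z)).
by have [_ _ <-] := mf z; rewrite -Dz -Db flag_orbit_aut.
Qed.

(** Here [h] is two steps of the rotation: the directions are g^i at even places and g^i s at odd
    ones, and [sign_span_generator] writes g = c^2 and s = c^j. *)
Lemma recognize_james :
    (forall y, O (rotate y) = O (r0 y)) -> (forall y, O (r0 y) <> O y) ->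
    (forall y, O (r0 (r2 y)) <> O y) ->
  (exists (F : finFieldType) (c : {unit F}) (c_gen : generator [set: {unit F}] c),
    [/\ #|F| = n, (5 <= n)%N & map_isomorphic M (petrie_dual (biggs_map c_gen))])
  \/
  (exists (F : finFieldType) (c : {unit F}) (c_gen : generator [set: {unit F}] c)
          (j : nat) (F3 : (#|F| %% 4)%N = 3%N) (odd_j : odd j),
    [/\ #|F| = n, (7 <= n)%N, (j < n.-1)%N, j <> 1%N
      & map_isomorphic M (petrie_dual (james_map c_gen F3 odd_j))]).
Proof.
move=> Orot nO0 nO02; have [col0 col1 col2 colG colx0] := coloring.
have Orot2 y : O (rotate (rotate y)) = O y.
  by rewrite Orot (flag_orbit_r0 (Orot y)) r0K.
have OrotX i : O (iter i.*2 rotate x0) = O x0.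
  by elim: i => // i IHi; rewrite doubleS !iterS Orot2.
have /esym/flag_orbitP[h Gh /esym Dh] := Orot2 x0.
have hx0 : vertex (h x0) = vertex x0 by rewrite Dh !(vertex_r2, vertex_r1).
have [k0 Kk0 Dk0] := transK (r0 x0).
have hX i : (h ^+ i)%g x0 = iter i.*2 rotate x0.
  by rewrite (@expg_rotate 2) // mul2n.
have stabE g : g \in map_aut M -> vertex (g x0) = vertex x0 ->
    exists i, g = (h ^+ i)%g.
  move=> Gg /(stab_iter Gg)[i Di]; exists i./2; apply: aut_eq => //.
    exact: groupX.
  (* After an odd number of steps the flag lies in the orbit of [r0 x0], not in that of [x0]. *)
  rewrite hX even_halfK //; apply: contraT; rewrite negbK => odd_i.
  case: (nO0 x0); rewrite -[RHS](flag_orbit_aut x0 Gg) Di.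
  rewrite -[i in RHS]odd_double_half odd_i add1n iterS Orot.
  by apply: flag_orbit_r0; rewrite OrotX.
have [F [l [g [Kl lD l_trans l_free [l1 lM dir1 dir_h]]]]] :=
  field_coordinates complete_M edge_transitive_M normalK transK freeK
    Gh hx0 Kk0 Dk0 stabE.
have l_aut v : l v \in map_aut M by apply: (subsetP (normal_sub normalK)) (Kl v).
set s := dir x0 l (rotate x0).
have dir_even i : dir x0 l (iter i.*2 rotate x0) = g ^+ i.
  by rewrite -hX (@dir_expg F l g h _ _ dir_h) dir1 mulr1.
have dir_odd i : dir x0 l (iter i.*2.+1 rotate x0) = g ^+ i * s.
  rewrite -(@dir_expg F l g h i (rotate x0) dir_h) -[rotate x0]/(iter 1 rotate x0).
  by rewrite aut_iter_rotate ?groupX // hX.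
have iter_parity y : vertex y = vertex x0 -> col y ->
    exists i, y = iter i.*2 rotate x0 \/ y = iter i.*2.+1 rotate x0.
  move=> Dv cy; have [i ->] := vertex_rotation coloring Dv cy; exists i./2.
  by rewrite -{1 3}[i]odd_double_half; case: (odd i); [right | left].
have no_inv (a : {perm flag M}) : a \in map_aut M -> (a * a = 1)%g -> a = 1%g.
  move=> Ga aa; apply/eqP/negPn/negP=> a1.
  have [O0|O02] := aut_involution complete_M nonorientable_M nonregular_M
    edge_transitive_M Ga a1 aa; [exact: (nO0 x0) | exact: (nO02 x0)].
have g0 : g != 0.
  by have := dir_neq0 complete_M l_trans l_free (h x0); rewrite dir_h dir1 mulr1.
have k01 : k0 != 1%g.
  apply/eqP=> k1; move: Dk0; rewrite k1 perm1 => /esym.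
  exact: loopless complete_M _.
have Gk0 : k0 \in map_aut M by rewrite -l1.
(* Equal directions would put [rotate x0], which is in the orbit of [r0 x0], into the orbit of
   [x0]. *)
have g_s i : g ^+ i != s.
  apply/eqP; rewrite -dir_even => Dd.
  have Drot : iter i.*2 rotate x0 = rotate x0.
    apply: (flag_uniq complete_M l_trans l_free col2 _ Dd).
      by apply/(pos_eq l_trans l_free); rewrite vertex_iter_rotate (vertex_iter_rotate 1).
    rewrite -hX colG ?groupX // colx0 /rotate col2 col1 colx0 //.
  by apply: (nO0 x0); rewrite -Orot -Drot OrotX.
(* If g^i = -1, then h^i inverts [k0]; its square centralizes [k0], hence is trivial, and so is h^i
   by [no_inv]. But then [k0] is an involution. *)
have g_N1 i : g ^+ i != -1.
  apply/eqP=> Dg; pose b := (h ^+ i)%g; have Gb : b \in map_aut M by rewrite groupX.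
  have lMX j v : l (g ^+ j * v) = (l v ^ (h ^+ j))%g.
    elim: j => [|j IHj]; first by rewrite mul1r conjg1.
    by rewrite exprS -mulrA lM IHj -conjgM expgSr.
  have kb : (k0 ^ b = k0^-1)%g.
    rewrite -l1 -lMX mulr1 Dg; apply: (mulgI (l 1)).
    by rewrite -lD subrr (translation0 lD) mulgV.
  have b1 : b = 1%g.
    apply: no_inv => //; apply: (stabilizer_semiregular complete_M nonorientable_M
      nonregular_M edge_transitive_M normalK freeK _ _ Kk0 k01).
    - exact: groupM.
    - by rewrite -expgD hX vertex_iter_rotate.
    - by rewrite conjgM kb conjVg kb invgK.
  case/eqP: k01; apply: no_inv => //.
  by rewrite -{1}[k0]invgK -kb b1 conjg1 mulVg.
have span d : d != 0 -> exists i, d = g ^+ i \/ d = g ^+ i * s.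
  move=> d0; have [y [Dv <- cy]] := dir_exists complete_M l_aut lD l_trans l_free col2 d0.
  have [i Dy] := iter_parity y Dv cy; exists i.
  by case: Dy => ->; [left | right].
have [F3 [c [j [c_gen Dc odd_j lt_j Ds]]]] := sign_span_generator g0 g_s g_N1 span.
(* For j = 1 the directions are in the order of the powers of c. *)
have [j1|nj1] := eqVneq j 1%N.
  left; have iso : map_isomorphic M (petrie_dual (biggs_map c_gen)).
    apply: (@coordinates_isomorphism M n x0 complete_M _ l l_aut lD l_trans l_free
              col col0 col1 col2 colG _ (biggs_rotation c_gen) (biggs_full c_gen)).
    move=> y Dv cy; have [i [->|->]] := iter_parity y Dv cy.
      rewrite -[r2 _]/(iter i.*2.+1 rotate x0) dir_odd dir_even.
      by rewrite next_biggs ?expf_neq0 // Ds j1 expr1 mulrC.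
    rewrite -[r2 _]/(iter i.+1.*2 rotate x0) dir_odd dir_even.
    rewrite next_biggs ?mulf_neq0 ?expf_neq0 // Ds j1 expr1.
      by rewrite mulrCA -expr2 Dc -exprSr.
    by have := prim_neq0 c 1.
  have Fn := card_of_isomorphism (biggs_full c_gen) iso.
  by exists F, c, c_gen; split=> //; move: F3 n_gt3; rewrite Fn; lia.
right; have iso : map_isomorphic M (petrie_dual (james_map c_gen F3 odd_j)).
  apply: (@coordinates_isomorphism M n x0 complete_M _ l l_aut lD l_trans l_free
            col col0 col1 col2 colG _ (james_rotation c_gen F3 odd_j)
            (james_full c_gen F3 odd_j)).
  move=> y Dv cy; have [i [->|->]] := iter_parity y Dv cy.
    rewrite -[r2 _]/(iter i.*2.+1 rotate x0) dir_odd dir_even Ds -Dc -!exprM.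
    by rewrite mul2n next_james_even // exprD mulrC.
  rewrite -[r2 _]/(iter i.+1.*2 rotate x0) dir_odd dir_even Ds -Dc -!exprM.
  by rewrite mulrC !mul2n -exprD next_james_odd.
have Fn := card_of_isomorphism (james_full c_gen F3 odd_j) iso.
exists F, c, c_gen, j, F3, odd_j; split=> //.
(* n is 3 modulo 4 and exceeds 3. *)
- by have := F3; rewrite Fn; move: n_gt3; lia.
- by rewrite -Fn.
- exact/eqP.
Qed.

End Recognition.

Theorem theorem1p5 (n : nat) (M : surface_map) :
  [/\ embeds_complete_graph M n, ~ orientable M, ~ regular_map M
    & edge_transitive_map M]
  <->
  (exists (F : finFieldType) (c : {unit F})
          (c_gen : generator [set: {unit F}] c),
     [/\ #|F| = n, (5 <= n)%N
       & map_isomorphic M (petrie_dual (biggs_map c_gen))])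
  \/
  (exists (F : finFieldType) (c : {unit F})
          (c_gen : generator [set: {unit F}] c) (j : nat)
          (F3 : (#|F| %% 4)%N = 3%N) (odd_j : odd j),
     [/\ #|F| = n, (7 <= n)%N, (j < n.-1)%N, j <> 1%N
       & map_isomorphic M (petrie_dual (james_map c_gen F3 odd_j))]).
Proof.
split=> [[/embeds_complete_graphP cM noM nrM etM] | ].
  have [x0 _|no_flag] := pickP {: flag M}; last first.
    by case: noM; exists (fun=> true) => x; have := no_flag x.
  have [K [nK tK fK]] := translation_group_exists cM noM nrM etM x0.
  have [col colP [Orot|[Orot n0 n02]]] := petrie_coloring_exists x0 cM noM nrM etM.
    by left; apply: (recognize_biggs cM noM nrM etM colP nK tK fK).
  exact: (recognize_james cM noM nrM etM colP nK tK fK).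
case=> [[F [c [c_gen [Fn n5 iso]]]] | [F [c [c_gen [j [F3 [oj [Fn n7 _ _ iso]]]]]]]].
  have iso' := map_isomorphic_sym iso; split.
  - rewrite -Fn; apply: (iso_embeds iso').
    exact: petrie_cayley_embeds (biggs_full c_gen) (card_finField_gt1 F).
  - move/(iso_orientable iso); apply: petrie_cayley_nonorientable.
      exact: biggs_full c_gen.
    by rewrite Fn; apply: leq_trans n5.
  - move/(iso_regular iso); apply: petrie_biggs_nonregular.
    by rewrite Fn.
  - exact: iso_edge_transitive iso' (petrie_biggs_edge_transitive c_gen).
have iso' := map_isomorphic_sym iso; split.
- rewrite -Fn; apply: (iso_embeds iso').
  exact: petrie_cayley_embeds (james_full c_gen F3 oj) (card_finField_gt1 F).
- move/(iso_orientable iso); apply: petrie_cayley_nonorientable.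
    by move=> d; apply: (james_full c_gen F3 oj).
  by rewrite Fn; apply: leq_trans n7.
- move/(iso_regular iso); apply: petrie_james_nonregular.
  by rewrite Fn.
- exact: iso_edge_transitive iso' (petrie_james_edge_transitive c_gen F3 oj).
Qed.
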